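(* Let $p$ be an odd prime number, $k$ a field with $\operatorname{char}(k)=p>0$, $a$ an integer such that $(\mathbb{Z}/p\mathbb{Z})^\times=\langle\bar a\rangle$, and $k(x_i,y_i:0\le i\le p-1)$ the rational function field of $2p$ variables over $k$. Let $\sigma_1,\sigma_2,\lambda_1,\lambda_2,\rho_1,\rho_2$ be the $k$-automorphisms of $k(x_i,y_i:0\le i\le p-1)$ defined, for $0\le i\le p-1$ and with the indices of $x_i$ and $y_i$ taken modulo $p$, by $$\sigma_1:x_i\mapsto x_{i+1},\ y_i\mapsto y_i;\qquad \sigma_2:x_i\mapsto x_i,\ y_i\mapsto y_{i+1};\qquad \lambda_1:x_i\mapsto y_{-i},\ y_i\mapsto x_i;$$ $$\lambda_2:x_i\mapsto y_i,\ y_i\mapsto x_i;\qquad \rho_1:x_i\mapsto x_{ai},\ y_i\mapsto y_i;\qquad \rho_2:x_i\mapsto x_i,\ y_i\mapsto y_{ai}.$$ Then the fixed subfield $k(x_i,y_i:0\le i\le p-1)^G$ is $k$-rational when $G$ is any one of the four groups $\langle\sigma_1,\sigma_2,\lambda_1,\rho_1\rho_2\rangle$, $\langle\sigma_1,\sigma_2,\lambda_1,\rho_1^{-1}\rho_2\rangle$, $\langle\sigma_1,\sigma_2,\lambda_2,\rho_1\rho_2\rangle$, $\langle\sigma_1,\sigma_2,\lambda_2,\rho_1^{-1}\rho_2\rangle$.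
   Context: A finitely generated field extension $L$ of $k$ is called $k$-rational if $L$ is purely transcendental over $k$, i.e. $k$-isomorphic to the quotient field of some polynomial ring over $k$. For a group $G$ acting on a field $L$ by automorphisms, $L^G$ denotes the fixed subfield. *)

(* Defs.v *)
From Stdlib Require List.
From HB Require Import structures.
From mathcomp Require Import all_boot all_order all_fingroup all_algebra.
From mathcomp Require Import mpoly.

Set Implicit Arguments.
Unset Strict Implicit.
Unset Printing Implicit Defensive.

Import GRing.Theory.
Local Open Scope ring_scope.

Section RationalFunctions.
Variables (k : fieldType) (I : finType).

(* k(t_i : i in I); the variables of {mpoly k[n]} are indexed by 'I_n, hence
   the detour through enum_rank : I -> 'I_#|I| in ratvar. *)
Definition ratfun : fieldType := {fraction {mpoly k[#|I|]}}.

Definition ratvar (i : I) : ratfun :=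
  FracField.tofrac ('X_(enum_rank i) : {mpoly k[#|I|]}).

Definition ratconst : k -> ratfun :=
  @FracField.tofrac {mpoly k[#|I|]} \o @mpolyC #|I| k.
HB.instance Definition _ := GRing.RMorphism.on ratconst.

End RationalFunctions.

Arguments ratvar k {I} i.
Arguments ratconst k I : clear implicits.

Section Extensions.
Variables (k L : fieldType) (iota : {rmorphism k -> L}).

(* iota presents L as an extension of k; bijectivity is recorded by a
   two-sided inverse. *)
Record kaut := KAut {
  kaut_fun :> {rmorphism L -> L};
  kaut_invfun : L -> L;
  kaut_funK : cancel kaut_fun kaut_invfun;
  kaut_invfunK : cancel kaut_invfun kaut_fun;
  kaut_const : forall c, kaut_fun (iota c) = iota c }.

Definition kaut_id : kaut :=
  @KAut idfun idfun (fun=> erefl) (fun=> erefl) (fun=> erefl).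

Section Operations.
Variables s t : kaut.

Fact kaut_comp_const c : (s \o t) (iota c) = iota c.
Proof. by rewrite /= !kaut_const. Qed.

Definition kaut_comp : kaut :=
  @KAut (s \o t) (kaut_invfun t \o kaut_invfun s)
    (can_comp (kaut_funK s) (kaut_funK t))
    (can_comp (kaut_invfunK t) (kaut_invfunK s)) kaut_comp_const.

Fact kaut_invfun_zmod : zmod_morphism (kaut_invfun s).
Proof. exact: can2_zmod_morphism (kaut_funK s) (kaut_invfunK s). Qed.
Fact kaut_invfun_monoid : monoid_morphism (kaut_invfun s).
Proof. exact: can2_monoid_morphism (kaut_funK s) (kaut_invfunK s). Qed.
HB.instance Definition _ :=
  GRing.isZmodMorphism.Build L L (kaut_invfun s) kaut_invfun_zmod.
HB.instance Definition _ :=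
  GRing.isMonoidMorphism.Build L L (kaut_invfun s) kaut_invfun_monoid.

Fact kaut_inv_const c : kaut_invfun s (iota c) = iota c.
Proof. by rewrite -{1}(kaut_const s) kaut_funK. Qed.

Definition kaut_inv : kaut :=
  @KAut (kaut_invfun s) s (kaut_invfunK s) (kaut_funK s) kaut_inv_const.

End Operations.

Inductive kaut_gen (S : seq kaut) : kaut -> Prop :=
| kaut_gen_mem s of List.In s S : kaut_gen S s
| kaut_gen_id : kaut_gen S kaut_id
| kaut_gen_comp s t of kaut_gen S s & kaut_gen S t :
    kaut_gen S (kaut_comp s t)
| kaut_gen_inv s of kaut_gen S s : kaut_gen S (kaut_inv s).

Definition fixed_subfield (G : kaut -> Prop) : L -> Prop :=
  fun z => forall s, G s -> s z = z.

(* The subfield F of L is k-rational: some k-morphism k(t_1, ..., t_n) -> L,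
   which is injective as a morphism of fields, has image F. *)
Definition k_rational (F : L -> Prop) : Prop :=
  exists (n : nat) (phi : {rmorphism ratfun k 'I_n -> L}),
    (forall c, phi (ratconst k 'I_n c) = iota c) /\
    (forall z, F z <-> exists w, phi w = z).

End Extensions.

Arguments kaut_id {k L iota}.

(* A k-automorphism of a rational function field is determined by its values on
   the variables, and every permutation of the variables arises; so prescribing
   such values, as theorem statements may do, is a definition. *)
Section PermutationOfVariables.

Section FractionMorphism.
Variables (R : idomainType) (L : fieldType) (f : {rmorphism R -> L}).
Hypothesis f_inj : injective f.

Definition frac_num (x : {fraction R}) : R := (frac (generic_quotient.repr x)).1.
Definition frac_den (x : {fraction R}) : R := (frac (generic_quotient.repr x)).2.

Lemma frac_den_neq0 x : frac_den x != 0.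
Proof. exact: denom_ratioP. Qed.

Lemma frac_numden x :
  x = FracField.tofrac (frac_num x) / FracField.tofrac (frac_den x).
Proof.
have d0 := frac_den_neq0 x.
apply/(@mulIf _ (FracField.tofrac (frac_den x))).
  by rewrite tofrac_eq0.
rewrite divfK ?tofrac_eq0 //.
rewrite -{1}[x]generic_quotient.reprK /frac_num /frac_den.
set r := generic_quotient.repr x.
unlock FracField.tofrac; rewrite -[LHS]FracField.pi_mul.
apply/generic_quotient.eqmodP.
rewrite /= FracField.equivfE /FracField.mulf.
rewrite !numden_Ratio ?mulr1 ?oner_eq0 ?denom_ratioP //.
by rewrite mulrC.
Qed.

Definition frac_map (x : {fraction R}) : L := f (frac_num x) / f (frac_den x).

Lemma frac_map_div a b : b != 0 ->
  frac_map (FracField.tofrac a / FracField.tofrac b) = f a / f b.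
Proof.
move=> b0; set x := _ / _; have d0 := frac_den_neq0 x.
have fn0 c : c != 0 -> f c != 0 by rewrite -(rmorph0 f) (inj_eq f_inj).
have /eqP := frac_numden x; rewrite {1}/x eqr_div ?tofrac_eq0 //.
rewrite -!tofracM tofrac_eq => /eqP e.
by apply/eqP; rewrite eq_sym eqr_div ?fn0 // -!rmorphM e.
Qed.

Lemma frac_map_tofrac a : frac_map (FracField.tofrac a) = f a.
Proof.
have := @frac_map_div a 1 (oner_neq0 _).
by rewrite tofrac1 rmorph1 !divr1.
Qed.

Fact frac_map_zmod : zmod_morphism frac_map.
Proof.
have fn0 c : c != 0 -> f c != 0 by rewrite -(rmorph0 f) (inj_eq f_inj).
move=> x y; have dx := frac_den_neq0 x; have dy := frac_den_neq0 y.
rewrite {1}[x]frac_numden {1}[y]frac_numden.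
rewrite -mulNr addf_div ?tofrac_eq0 // -tofracN -!tofracM -tofracD.
rewrite frac_map_div ?mulf_neq0 // /frac_map -mulNr addf_div ?fn0 //.
by rewrite !(rmorphD, rmorphM, rmorphN).
Qed.

Fact frac_map_monoid : monoid_morphism frac_map.
Proof.
split=> [|x y]; first by rewrite -tofrac1 frac_map_tofrac rmorph1.
have dx := frac_den_neq0 x; have dy := frac_den_neq0 y.
rewrite {1}[x]frac_numden {1}[y]frac_numden.
rewrite mulf_div -!tofracM frac_map_div ?mulf_neq0 //.
by rewrite !rmorphM /frac_map mulf_div.
Qed.

End FractionMorphism.

Lemma frac_morph_ext (R : idomainType) (L : fieldType)
    (f g : {rmorphism {fraction R} -> L}) :
  (forall a, f (FracField.tofrac a) = g (FracField.tofrac a)) -> f =1 g.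
Proof. by move=> e x; rewrite [x]frac_numden !fmorph_div !e. Qed.

Variables (k : fieldType) (I : finType).
Local Notation K := (ratfun k I).
Local Notation P := {mpoly k[#|I|]}.

Lemma ratfun_morph_ext (L : fieldType) (f g : {rmorphism K -> L}) :
    (forall c, f (ratconst k I c) = g (ratconst k I c)) ->
    (forall i, f (ratvar k i) = g (ratvar k i)) ->
  f =1 g.
Proof.
move=> ec ev; apply: frac_morph_ext => p.
elim/mpolyind: p => [|c m p _ _ IHp]; first by rewrite !rmorph0.
rewrite !rmorphD IHp; congr (_ + _).
rewrite -mul_mpolyC !rmorphM; congr (_ * _); first exact: ec.
rewrite mpolyXE_id !rmorph_prod; apply: eq_bigr => i _.
rewrite !rmorphXn; congr (_ ^+ _).
by have := ev (enum_val i); rewrite /ratvar enum_valK.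
Qed.

Lemma kaut_perm_exists (s : {perm I}) :
  exists g : kaut (ratconst k I), forall i, g (ratvar k i) = ratvar k (s i).
Proof.
pose u (s : {perm I}) (j : 'I_#|I|) := enum_rank (s (enum_val j)).
have u_inj s' : injective (u s').
  by move=> i j /enum_rank_inj/perm_inj/enum_val_inj.
pose v s' := perm (u_inj s').
pose h s' : P -> K := @FracField.tofrac P \o msym (v s').
have hinj s' : injective (h s' : {rmorphism P -> K}).
  move=> p q /eqP; rewrite /= tofrac_eq => /eqP e.
  by rewrite -[p]msym1m -[q]msym1m -(mulgV (v s')) !msymMm e.
pose F0 s' := @frac_map P K (h s').
pose F s' : {rmorphism K -> K} := HB.pack (F0 s')
  (GRing.isZmodMorphism.Build K K (F0 s') (frac_map_zmod (hinj s')))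
  (GRing.isMonoidMorphism.Build K K (F0 s') (frac_map_monoid (hinj s'))).
have Fc s' c : F s' (ratconst k I c) = ratconst k I c.
  rewrite [LHS](frac_map_tofrac (hinj s')) /= /h /ratconst /=.
  by congr FracField.tofrac; rewrite /msym mmapC.
have Fv s' i : F s' (ratvar k i) = ratvar k (s' i).
  rewrite [LHS](frac_map_tofrac (hinj s')) /= /h /ratvar /=.
  by congr FracField.tofrac; rewrite /msym mmapX mmap1U permE /u enum_rankK.
have FK (s1 s2 : {perm I}) : (forall i, s2 (s1 i) = i) -> cancel (F s1) (F s2).
  move=> e; apply: (@ratfun_morph_ext K (F s2 \o F s1) idfun) => [c|i].
    exact: etrans (congr1 (F s2) (Fc s1 c)) (Fc s2 c).
  by apply: (etrans (congr1 (F s2) (Fv s1 i))); rewrite Fv e.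
exists (@KAut k K (ratconst k I) (F s) (F s^-1%g)
  (FK _ _ (permK s)) (FK _ _ (permKV s)) (Fc s)) => i.
exact: Fv.
Qed.

Lemma kaut_perm_unique (g h : kaut (ratconst k I)) :
  (forall i, g (ratvar k i) = h (ratvar k i)) -> g =1 h.
Proof. by apply: ratfun_morph_ext => c; rewrite !kaut_const. Qed.

End PermutationOfVariables.

(* Main.v *)
(* For X = (x_i) or (y_i) put z = (sum_i i X_i) / (sum_i X_i), Z = z^p - z and
   tau_j = (sum_i (i - z)^j X_i) / Z^j.  The substitution X_i -> X_(u i + d)
   sends z to (z - d) / u and Z to Z / u and fixes every tau_j.  Lagrange
   interpolation recovers the X_i from z and the tau_j (tau_1 = 0), so the fixed
   field of <sigma_1, sigma_2> is k(Z, W) with the tau_j of x and y adjoined,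
   where W is the Z of y.  The remaining generators act on Z, W by monomial
   substitutions and exchange the tau_j of x and y.  For q = Z / W, resp.
   q = (Z / W)^((p-1)/2), lambda sends q to r = +-1/q, so delta = q - r changes
   sign under lambda, and the fixed field is generated by q + r, one more
   element of k(Z, W), and the elements tau_j(x) + tau_j(y) and
   delta (tau_j(x) - tau_j(y)).  These are 2p elements over which k(x, y) is
   algebraic, hence they are algebraically independent by the exchange lemma.
   That an invariant lies in the smaller field is proved for one generator
   theta at a time: a polynomial of degree < n in theta which is invariant takes
   the same value at the n conjugates of theta, hence is constant. *)
Require Import Defs.
From HB Require Import structures.
From mathcomp Require Import all_boot all_order all_fingroup all_algebra.
From mathcomp Require Import cyclic finfield mpoly ring.
From mathcomp Require Import boolp.

Set Implicit Arguments.
Unset Strict Implicit.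
Unset Printing Implicit Defensive.

Import GRing.Theory.
Local Open Scope ring_scope.

(** * Adjunction and algebraic dependence *)

Section SubfieldOf.
Variables (L : fieldType) (S : divringClosed L).

Inductive subfield_of := SubfieldOf x of x \in S.
Definition subfield_val u := let: SubfieldOf x _ := u in x.

HB.instance Definition _ := [isSub for subfield_val].
HB.instance Definition _ := [Choice of subfield_of by <:].
HB.instance Definition _ := [SubChoice_isSubIntegralDomain of subfield_of by <:].
HB.instance Definition _ := [SubIntegralDomain_isSubField of subfield_of by <:].

Lemma polyOver_subfield (p : {poly L}) : p \is a polyOver S ->
  exists q : {poly subfield_of}, p = map_poly val q.
Proof.
move=> /polyOverP pS; exists (\poly_(i < size p) SubfieldOf (pS i)).
apply/polyP=> i; rewrite coef_map coef_poly; case: ltnP => // le_p_i.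
by rewrite nth_default ?raddf0.
Qed.

End SubfieldOf.

(** * Fractions of elements in the image of a ring morphism *)

Section FractionsOfImage.
Variables (A : comNzRingType) (L : fieldType) (e : {rmorphism A -> L}).

Definition frac_image : {pred L} :=
  fun z => `[< exists a b, e b != 0 /\ z = e a / e b >].

Lemma frac_imageP z :
  reflect (exists a b, e b != 0 /\ z = e a / e b) (z \in frac_image).
Proof. exact: asboolP. Qed.

Lemma frac_image_id a : e a \in frac_image.
Proof. by apply/frac_imageP; exists a, 1; rewrite rmorph1 oner_neq0 divr1. Qed.

Fact frac_image_divring : divring_closed frac_image.
Proof.
split=> [|x y|x y]; first by rewrite -(rmorph1 e) frac_image_id.
- move=> /frac_imageP[a [b [b0 ->]]] /frac_imageP[c [d [d0 ->]]].
  apply/frac_imageP; exists (a * d - c * b), (b * d).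
  split; first by rewrite rmorphM mulf_neq0.
  by rewrite -mulNr addf_div // rmorphB !rmorphM mulNr.
- move=> /frac_imageP[a [b [b0 ->]]] /frac_imageP[c [d [d0 ->]]].
  (* A quotient by 0 is 0 by convention, which is the image of 0. *)
  have [c0|c0] := eqVneq (e c) 0.
    by rewrite c0 mul0r invr0 mulr0 -(rmorph0 e) frac_image_id.
  apply/frac_imageP; exists (a * d), (b * c).
  split; first by rewrite rmorphM mulf_neq0.
  by rewrite !rmorphM invf_div mulf_div.
Qed.
HB.instance Definition _ :=
  GRing.isDivringClosed.Build L frac_image frac_image_divring.

(** One denominator serves all coefficients: induction along Horner's scheme multiplies it by the
    denominator of each new coefficient. *)
Lemma frac_image_poly (Q : {poly L}) : Q \is a polyOver frac_image ->
  exists b (R : {poly A}), e b != 0 /\ map_poly e R = e b *: Q.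
Proof.
elim/poly_ind: Q => [_|Q c IHQ].
  by exists 1, 0; rewrite rmorph1 oner_neq0 rmorph0 scaler0.
move=> /polyOverP FQ.
have [|b [R [b0 eR]]] := IHQ.
  by apply/polyOverP=> i; have := FQ i.+1; rewrite coefD coefMX coefC addr0.
have := FQ 0; rewrite coefD coefMX coefC add0r => /frac_imageP[d [d' [d0 ->]]].
exists (b * d'), (d' *: R * 'X + (b * d)%:P); split.
  by rewrite rmorphM mulf_neq0.
rewrite rmorphD /= [map_poly e (_ * 'X)]rmorphM /= map_polyX map_polyC /=.
rewrite map_polyZ /= eR [e (b * d)]rmorphM [e (b * d')]rmorphM scalerDr.
rewrite -!scalerAl scalerA [e d' * _]mulrC; congr (_ + _).
rewrite -mul_polyC -polyCM; congr _%:P.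
by rewrite mulrACA mulfV ?mulr1.
Qed.

End FractionsOfImage.

(** * Generated subfields, algebraic elements and the exchange lemma *)

Section Adjunction.
Variables (k L : fieldType) (iota : {rmorphism k -> L}).
Implicit Types (s t : seq L) (x y z u v : L).

(** The field k(s). With the constants present, differences and quotients already yield sums,
    products and inverses. *)
Inductive adjoin_spec s : L -> Prop :=
| AdjoinConst c : adjoin_spec s (iota c)
| AdjoinMem x of x \in s : adjoin_spec s x
| AdjoinSub x y of adjoin_spec s x & adjoin_spec s y : adjoin_spec s (x - y)
| AdjoinDiv x y of adjoin_spec s x & adjoin_spec s y : adjoin_spec s (x / y).

Definition adjoin s : {pred L} := fun z => `[< adjoin_spec s z >].

Fact adjoin_divring s : divring_closed (adjoin s).
Proof.
split=> [|x y|x y].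
- by apply/asboolP; rewrite -(rmorph1 iota); apply: AdjoinConst.
- by move=> /asboolP sx /asboolP sy; apply/asboolP/AdjoinSub.
- by move=> /asboolP sx /asboolP sy; apply/asboolP/AdjoinDiv.
Qed.
HB.instance Definition _ s :=
  GRing.isDivringClosed.Build L (adjoin s) (adjoin_divring s).

Lemma adjoin_const s c : iota c \in adjoin s.
Proof. exact/asboolP/AdjoinConst. Qed.

Lemma mem_adjoin s x : x \in s -> x \in adjoin s.
Proof. by move=> sx; apply/asboolP/AdjoinMem. Qed.

Lemma adjoin_min s (S : divringClosed L) :
    (forall c, iota c \in S) -> {subset s <= S} -> {subset adjoin s <= S}.
Proof.
move=> cS sS z /asboolP; elim=> {z} [c|x /sS|x y _ ? _ ?|x y _ ? _ ?] //.
  exact: rpredB.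
exact: rpred_div.
Qed.

Lemma adjoin_sub s t : {subset s <= adjoin t} -> {subset adjoin s <= adjoin t}.
Proof. exact/adjoin_min/adjoin_const. Qed.

Lemma adjoinS s t : {subset s <= t} -> {subset adjoin s <= adjoin t}.
Proof. by move=> st; apply: adjoin_sub => x /st /mem_adjoin. Qed.

(** The algebraic closure of k(s) inside L. The polynomial lives over L with coefficients
    constrained to k(s), so no subfield type enters; [algP] passes to [algebraicOver]. *)
Definition alg s : {pred L} := fun z => `[< exists2 Q : {poly L},
  Q \is a polyOver (adjoin s) & Q != 0 /\ root Q z >].

Local Notation K s := (subfield_of (adjoin s)).
Local Notation inK s := (val : K s -> L).

Lemma algP s z : reflect (algebraicOver (inK s) z) (z \in alg s).
Proof.
apply: (iffP (asboolP _)) => [[Q QS [Q0 Qz]] | [q q0 qz]].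
  have [q Qq] := polyOver_subfield QS.
  by exists q; rewrite -?Qq //; apply: contraNneq Q0 => q0; rewrite Qq q0 rmorph0.
exists (map_poly (inK s) q); last by rewrite map_poly_eq0.
by apply/polyOverP=> i; rewrite coef_map /=; case: (q`_i).
Qed.

Fact alg_divring s : divring_closed (alg s).
Proof.
split=> [|x y /algP ax /algP ay|x y /algP ax /algP ay]; apply/algP.
- exact: algebraic1.
- exact: algebraic_sub.
- exact: algebraic_div.
Qed.
HB.instance Definition _ s :=
  GRing.isDivringClosed.Build L (alg s) (alg_divring s).

Lemma adjoin_alg s : {subset adjoin s <= alg s}.
Proof.
by move=> z sz; apply/algP; apply: (algebraic_id _ (SubfieldOf sz : K s)).
Qed.

Lemma mem_alg s x : x \in s -> x \in alg s.
Proof. by move=> /mem_adjoin/adjoin_alg. Qed.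

(** Transitivity of algebraicity: over a field algebraic means integral, and a root of a nonzero
    polynomial with integral coefficients is integral. *)
Lemma alg_root s (Q : {poly L}) z :
  Q \is a polyOver (alg s) -> Q != 0 -> root Q z -> z \in alg s.
Proof.
move=> /polyOverP QS Q0 Qz; apply/algP/integral_algebraic.
apply: (integral_root Q0 Qz); apply/integral_poly => i.
exact/integral_algebraic/algP.
Qed.

Lemma alg_expr s n z : (0 < n)%N -> z ^+ n \in alg s -> z \in alg s.
Proof.
move=> n0 sz; apply: (@alg_root s ('X^n - (z ^+ n)%:P)).
- by rewrite rpredB ?rpredX ?polyOverX ?polyOverC.
- by rewrite -size_poly_gt0 size_XnsubC.
- by rewrite rootE !hornerE subrr.
Qed.

Lemma alg_sub s t : {subset s <= alg t} -> {subset alg s <= alg t}.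
Proof.
move=> st z /asboolP[Q QS [Q0 Qz]]; apply: (alg_root _ Q0 Qz).
apply/polyOverP=> i; apply: (@adjoin_min s (alg t)) => [c||] //.
  exact/adjoin_alg/adjoin_const.
exact: (polyOverP QS).
Qed.

Lemma algS s t : {subset s <= t} -> {subset alg s <= alg t}.
Proof. by move=> st; apply: alg_sub => x /st/mem_alg. Qed.

(** The fractions form a subfield, so it is enough to reach the constants and the generators. This
    turns membership in k(s) into an explicit quotient. *)
Lemma adjoin_frac_image (A : comNzRingType) (e : {rmorphism A -> L}) s :
    (forall c, exists a, e a = iota c) -> {in s, forall x, exists a, e a = x} ->
  {subset adjoin s <= frac_image e}.
Proof.
move=> ec es; apply: adjoin_min => [c|x /es[a <-]]; last exact: frac_image_id.
by have [a <-] := ec c; apply: frac_image_id.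
Qed.

(* The relation clearing denominators in an equation of u over s and v is a
   bivariate polynomial over s; reading it as a polynomial in v gives the
   exchange. *)
Lemma alg_exchange s u v :
  u \in alg (v :: s) -> u \notin alg s -> v \in alg (u :: s).
Proof.
move=> /asboolP[Q QS [Q0 Qu]] nu.
pose ev w : {rmorphism {poly K s} -> L} := horner_eval w \o map_poly (inK s).
have evH w p : ev w p = (map_poly (inK s) p).[w] by [].
have evC w a : ev w a%:P = inK s a.
  by rewrite evH map_polyC hornerC.
have evX w : ev w 'X = w.
  by rewrite evH map_polyX hornerX.
have [b [R [b0 eR]]] : exists b (R : {poly {poly K s}}),
    ev v b != 0 /\ map_poly (ev v) R = ev v b *: Q.
  apply: frac_image_poly; apply/polyOverP=> i.
  apply: adjoin_frac_image (polyOverP QS i) => [c|x].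
    by exists (SubfieldOf (adjoin_const s c) : K s)%:P; rewrite evC.
  rewrite inE => /predU1P[->|/mem_adjoin sx].
    by exists 'X; rewrite evX.
  by exists (SubfieldOf sx : K s)%:P; rewrite evC.
have R0 : R != 0.
  apply: contraNneq Q0 => R0; move/eqP: eR.
  by rewrite R0 rmorph0 eq_sym scaler_eq0 (negPf b0).
have Ru : (map_poly (ev v) R).[u] = 0 by rewrite eR hornerZ (rootP Qu) mulr0.
have swapE : (map_poly (ev u) (swapXY R)).[v] = (map_poly (ev v) R).[u].
  have evE w T : map_poly (ev w) T =
      map_poly (horner_eval w) (map_poly (map_poly (inK s)) T).
    by rewrite map_poly_comp.
  rewrite !evE -swapXY_map -horner_polyC -[in RHS]horner_swapXY.
  by rewrite horner2_swapXY.
(* Otherwise u would be a root of the leading coefficient of [swapXY R], a nonzero polynomial over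
   k(s). *)
have : map_poly (ev u) (swapXY R) != 0.
  apply: contraNneq nu => S0; have := R0; rewrite -swapXY_eq0 -lead_coef_eq0.
  set q := lead_coef _ => q0; apply/algP; exists q => //.
  by have := congr1 (fun p : {poly L} => p`_(size (swapXY R)).-1) S0;
     rewrite coef_map coef0 => /eqP.
move=> S0; apply: (alg_root _ S0); last by rewrite rootE swapE Ru.
apply/polyOverP=> i; rewrite coef_map -[X in X \in _]/(ev u _) evH.
apply: adjoin_alg; apply: rpred_horner; last by rewrite mem_adjoin ?mem_head.
apply/polyOverP=> j; rewrite coef_map /=.
by apply: (@adjoinS s) (valP _) => x /(@mem_behead _ (u :: s)).
Qed.

(** Algebraic independence in the one-sided form that suits induction on lists. *)
Fixpoint alg_free t : Prop :=
  if t is x :: t' then x \notin alg t' /\ alg_free t' else True.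

(** Elements of s are passed over from the front while x stays algebraic over t and the rest; the
    first one that matters is traded for x. There is one, since x is not algebraic over t. *)
Lemma alg_exchange_seq t s x : x \in alg (t ++ s) -> x \notin alg t ->
  exists2 s', (size s').+1 = size s & {subset s <= alg (x :: t ++ s')}.
Proof.
elim: s => [|v r IHr]; first by rewrite cats0 => ->.
move=> xvr nxt; have [/IHr[//|r' szr' sr']|nxr] := boolP (x \in alg (t ++ r)).
  exists (v :: r') => [|y]; first by rewrite /= szr'.
  rewrite inE => /predU1P[->|/sr' yr'].
    by apply: mem_alg; rewrite !(inE, mem_cat) eqxx !orbT.
  apply: algS yr' => z; rewrite !(inE, mem_cat).
  by case/or3P=> ->; rewrite ?orbT.
exists r => // y; rewrite inE => /predU1P[->|yr].
  apply: alg_exchange nxr; apply: algS xvr => z; rewrite !(inE, mem_cat).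
  by case/or3P=> ->; rewrite ?orbT.
by apply: mem_alg; rewrite !(inE, mem_cat) yr !orbT.
Qed.

(** Steinitz exchange: the elements of t enter one by one, each pushing out one element of s. *)
Lemma steinitz t s : alg_free t -> {subset t <= alg s} ->
  exists2 s', (size t + size s')%N = size s & {subset s <= alg (t ++ s')}.
Proof.
elim: t => [_ _|x t IHt [nxt ft] xts].
  by exists s => // y; apply: mem_alg.
have [|s1 sz1 ss1] := IHt ft; first by move=> y yt; apply/xts/mem_behead.
have [|s2 sz2 ss2] := @alg_exchange_seq t s1 x _ nxt.
  exact: alg_sub ss1 _ (xts _ (mem_head _ _)).
exists s2 => [|y /ss1 ys1]; first by rewrite /= addSnnS sz2.
apply: alg_sub ys1 => z; rewrite mem_cat => /orP[zt|/ss2 //].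
by apply: mem_alg; rewrite !(inE, mem_cat) zt orbT.
Qed.

Lemma alg_free_size t s : alg_free t -> {subset t <= alg s} ->
  (size t <= size s)%N.
Proof. by move=> ft /(steinitz ft)[s' <- _]; apply: leq_addr. Qed.

End Adjunction.

(** * Polynomial relations among elements of L *)

Section AlgebraicDependence.
Variables (k L : fieldType) (iota : {rmorphism k -> L}).
Local Notation widen := (widen_ord (leqnSn _)).

(** Evaluation in two stages, the last variable at the end; this drives the induction on the number
    of variables. *)
Lemma mmap_muni n (R : comNzRingType) (j : {rmorphism k -> R})
    (g : 'I_n.+1 -> R) (P : {mpoly k[n.+1]}) :
  mmap j g P = (map_poly (mmap j (g \o widen)) (muni P)).[g ord_max].
Proof.
rewrite muniE [LHS]/mmap rmorph_sum horner_sum; apply: eq_bigr => m _ /=.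
rewrite -mul_polyC [map_poly _ (_ * _)]rmorphM /= map_polyC /= map_polyXn.
rewrite hornerCM hornerXn mmapZ mmapX -mulrA; congr (_ * _).
rewrite /mmap1 big_ord_recr /=; congr (_ * _).
by apply: eq_bigr => i _; rewrite mnmE.
Qed.

(** Evaluating at the variables themselves gives P back, and [mmap_muni] computes that value from
    [muni P]. *)
Lemma muni_eq0 n (P : {mpoly k[n.+1]}) : (muni P == 0) = (P == 0).
Proof.
apply/eqP/eqP=> [P0|->]; last exact: muni0.
have := @mmap_muni n {mpoly k[n.+1]} (@mpolyC _ k) (fun i => 'X_i) P.
rewrite P0 rmorph0 horner0 => <-.
by rewrite [LHS]mpolyE; apply: eq_bigr => m _; rewrite mmap1_id mul_mpolyC.
Qed.

Lemma mpoly_morph_ext n (R : comNzRingType) (f g : {rmorphism {mpoly k[n]} -> R}) :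
  (forall c, f c%:MP = g c%:MP) -> (forall i, f 'X_i = g 'X_i) -> f =1 g.
Proof.
move=> ec eX; elim/mpolyind=> [|c m p _ _ IHp]; first by rewrite !rmorph0.
rewrite !rmorphD IHp -mul_mpolyC !rmorphM ec mpolyXE_id !rmorph_prod.
by congr (_ * _ + _); apply: eq_bigr => i _; rewrite !rmorphXn eX.
Qed.

Lemma rpred_mmap n (S : subringClosed L) (g : 'I_n -> L) (P : {mpoly k[n]}) :
  (forall c, iota c \in S) -> (forall i, g i \in S) -> mmap iota g P \in S.
Proof.
move=> cS gS; rewrite /mmap; apply: rpred_sum => m _.
by rewrite rpredM // rpred_prod // => i _; rewrite rpredX.
Qed.

(** Substitute the first n values. If a nonzero polynomial in the last variable remains, the last
    value is algebraic over the others; if not, the leading coefficient of [muni P] is a relation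
    among the first n values and induction applies. *)
Lemma mmap_eq0_shrink n (g : 'I_n -> L) (P : {mpoly k[n]}) :
    P != 0 -> mmap iota g P = 0 ->
  exists2 t, (size t < n)%N & forall i, g i \in alg iota t.
Proof.
elim: n => [|n IHn] in g P *.
  have -> : P = (P@_0)%:MP.
    apply/mpolyP=> m; have -> : m = 0%MM by apply/mnmP; case.
    by rewrite mcoeffC eqxx mulr1.
  rewrite mmapC mpolyC_eq0 => c0 /eqP.
  by rewrite fmorph_eq0 (negPf c0).
move=> P0; rewrite mmap_muni; set ev := mmap _ _; set Q := map_poly _ _ => Pg0.
have [Q0|Q0] := eqVneq Q 0.
  have q0 : lead_coef (muni P) != 0 by rewrite lead_coef_eq0 muni_eq0.
  have [|t szt tg] := IHn (g \o widen) _ q0.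
    have := congr1 (fun p : {poly L} => p`_(size (muni P)).-1) Q0.
    by rewrite coef_map coef0.
  exists (g ord_max :: t) => // i; have [j ->|->] := unliftP ord_max i.
    have -> : lift ord_max j = widen j by apply/val_inj/lift_max.
    by apply: algS (tg j) => x xt; rewrite inE xt orbT.
  exact/mem_alg/mem_head.
exists (codom (g \o widen)); first by rewrite size_codom card_ord.
have gm j : g (widen j) \in alg iota (codom (g \o widen)).
  exact/mem_alg/codom_f.
move=> i; have [j ->|->] := unliftP ord_max i.
  have -> : lift ord_max j = widen j by apply/val_inj/lift_max.
  exact: gm.
apply: (alg_root _ Q0); last exact/eqP.
apply/polyOverP=> l; rewrite coef_map; apply: rpred_mmap => // c.
exact/adjoin_alg/adjoin_const.
Qed.
End AlgebraicDependence.

(** * Independence of the variables of a rational function field *)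

Section Ratvars.
Variables (k : fieldType) (I : finType).
Local Notation L := (ratfun k I).
Local Notation iota := (ratconst k I).
Local Notation P := {mpoly k[#|I|]}.
Local Notation toL := (@FracField.tofrac P).

Lemma ratfun_adjoin s : (forall i, ratvar k i \in adjoin iota s) ->
  forall z : L, z \in adjoin iota s.
Proof.
move=> sv z; rewrite [z]frac_numden.
suff sP p : toL p \in adjoin iota s by rewrite rpred_div.
elim/mpolyind: p => [|c m p _ _ IHp]; first by rewrite rmorph0 rpred0.
rewrite rmorphD rpredD // -mul_mpolyC rmorphM rpredM //.
  exact: adjoin_const.
rewrite mpolyXE_id rmorph_prod rpred_prod // => j _.
rewrite rmorphXn rpredX //.
by have := sv (enum_val j); rewrite /ratvar enum_valK.
Qed.

(* The substitution X_i = 0 has its image in the polynomials not involving X_i,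
   over which X_i satisfies no equation: mark X_i by an outer variable. *)
Lemma ratvar_notin_alg i (r : seq I) :
  i \notin r -> ratvar k i \notin alg iota (map (ratvar k) r).
Proof.
move=> nir; apply/negP=> /asboolP[Q QS [Q0 Qi]]; pose i0 := enum_rank i.
have [pi [piC piX]] : exists pi : {rmorphism P -> P},
    (forall c, pi c%:MP = c%:MP) /\
    forall j, pi 'X_j = if j == i0 then 0 else 'X_j.
  exists (mmap (@mpolyC _ k) (fun j => if j == i0 then 0 else 'X_j)).
  by split=> [c|j] /=; rewrite ?mmapC // mmapX mmap1U.
have [D [DC DX]] : exists D : {rmorphism P -> {poly P}},
    (forall c, D c%:MP = c%:MP%:P) /\
    forall j, D 'X_j = if j == i0 then 'X else ('X_j)%:P.
  exists (mmap (polyC \o @mpolyC _ k)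
               (fun j => if j == i0 then 'X else ('X_j)%:P)).
  by split=> [c|j] /=; rewrite ?mmapC // mmapX mmap1U.
have Dpi p : D (pi p) = (pi p)%:P.
  pose f : {rmorphism P -> {poly P}} := D \o pi.
  pose g : {rmorphism P -> {poly P}} := polyC \o pi.
  apply: (@mpoly_morph_ext _ _ _ f g) => [c|j] /=; first by rewrite piC DC.
  by rewrite piX; case: (eqVneq j i0) => [_|ji]; rewrite ?rmorph0 // DX (negPf ji).
pose e : {rmorphism P -> L} := toL \o pi.
have eE p : e p = toL (pi p) by [].
have [b [R [b0 eR]]] : exists b (R : {poly P}),
    e b != 0 /\ map_poly e R = e b *: Q.
  apply: frac_image_poly; apply/polyOverP=> j.
  apply: adjoin_frac_image (polyOverP QS j) => [c|x /mapP[l rl ->]].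
    by exists c%:MP; rewrite eE piC.
  exists 'X_(enum_rank l); rewrite eE piX (inj_eq enum_rank_inj).
  by case: eqP => // li; rewrite -li rl in nir.
have RX : (map_poly pi R).['X_i0] = 0.
  apply/eqP; rewrite -tofrac_eq0; apply/eqP.
  have <- : (map_poly e R).[ratvar k i] = toL (map_poly pi R).['X_i0].
    rewrite -(horner_map toL) /= -map_poly_comp.
    by [].
  by rewrite eR hornerZ (rootP Qi) mulr0.
have piR : map_poly pi R = 0.
  have := congr1 D RX.
  rewrite -(horner_map D) DX eqxx rmorph0 /= -map_poly_comp.
  (* By [Dpi] the coefficients are constants in the outer variable, and evaluating at that variable
     gives the polynomial back. *)
  rewrite (eq_map_poly (g := polyC \o pi)) // map_poly_comp.
  by rewrite -/(_ \Po _) comp_polyXr.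
move: eR; rewrite /e map_poly_comp piR rmorph0 => /esym/eqP.
by rewrite scaler_eq0 (negPf b0) (negPf Q0).
Qed.

Lemma alg_free_ratvar (r : seq I) :
  uniq r -> alg_free iota (map (ratvar k) r).
Proof. by elim: r => //= i r IHr /andP[/ratvar_notin_alg ? /IHr]. Qed.

Lemma ratvar_alg_size s : (forall i, ratvar k i \in alg iota s) ->
  (#|I| <= size s)%N.
Proof.
move=> sv; have := alg_free_size (alg_free_ratvar (enum_uniq I)).
rewrite size_map -cardE; apply=> _ /mapP[i _ ->]; exact: sv.
Qed.
End Ratvars.

(** A relation among the elements of s would make the variables algebraic over fewer than [#|I|]
    elements, against [ratvar_alg_size]. Hence evaluation at s is injective and extends to
    fractions. *)
Lemma k_rational_adjoin (k : fieldType) (I : finType)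
    (s : seq (ratfun k I)) (F : ratfun k I -> Prop) :
    size s = #|I| -> (forall i, ratvar k i \in alg (ratconst k I) s) ->
    (forall z, F z <-> z \in adjoin (ratconst k I) s) ->
  k_rational (ratconst k I) F.
Proof.
move=> szs sv FE; pose L := ratfun k I; pose iota := ratconst k I.
pose n := size s; pose g (j : 'I_#|'I_n|) : L := s`_(enum_val j).
pose ev : {rmorphism {mpoly k[#|'I_n|]} -> L} := mmap iota g.
have ev_inj : injective ev.
  apply: raddf_inj => P P0; apply/eqP/negPn/negP=> /mmap_eq0_shrink/(_ P0).
  case=> t ltt gt; have := ltt; rewrite card_ord /n szs ltnNge => /negP[].
  apply: ratvar_alg_size => i; apply: alg_sub (sv i) => x /(nthP 0)[j ltj <-].
  by have := gt (enum_rank (Ordinal ltj)); rewrite /g enum_rankK.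
pose phi : {rmorphism ratfun k 'I_n -> L} := HB.pack (frac_map ev)
  (GRing.isZmodMorphism.Build _ _ (frac_map ev) (frac_map_zmod ev_inj))
  (GRing.isMonoidMorphism.Build _ _ (frac_map ev) (frac_map_monoid ev_inj)).
have phiE P : phi (FracField.tofrac P) = ev P by apply: frac_map_tofrac.
have phic c : phi (ratconst k 'I_n c) = iota c.
  by rewrite [LHS]phiE /ev /= mmapC.
exists n, phi; split=> // z; rewrite FE; split=> [|[w <-]].
  move=> sz; have zphi : z \in frac_image phi.
    apply: adjoin_frac_image sz => [c|x /(nthP 0)[j ltj <-]].
      by exists (ratconst k 'I_n c).
    exists (ratvar k (Ordinal ltj)); rewrite [LHS]phiE /ev /= mmapX mmap1U.
    by rewrite /g enum_rankK.
  have /frac_imageP[a [b [_ ->]]] := zphi.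
  by exists (a / b); rewrite fmorph_div.
rewrite [w]frac_numden fmorph_div !phiE.
have evs P : ev P \in adjoin iota s.
  apply: rpred_mmap => [c|j]; first exact: adjoin_const.
  by apply/mem_adjoin/mem_nth.
exact: rpred_div.
Qed.

(** * Fixed elements of a simple algebraic extension *)

Section FixedElements.
Variables (k L : fieldType) (iota : {rmorphism k -> L}).

Lemma min_annihilator (K : fieldType) (f : {rmorphism K -> L}) (z : L)
    (p : {poly K}) : p != 0 -> root (map_poly f p) z ->
  exists q : {poly K}, [/\ q != 0, root (map_poly f q) z, (size q <= size p)%N &
    forall r, r != 0 -> root (map_poly f r) z -> (size q <= size r)%N].
Proof.
have [m] := ubnP (size p); elim: m => // m IHm in p * => ltpm p0 pz.
have [[r [r0 rz ltrp]]|nr] := pselect (exists r : {poly K},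
    [/\ r != 0, root (map_poly f r) z & (size r < size p)%N]).
  have [|q [q0 qz leqr qmin]] := IHm r _ r0 rz; first exact: leq_trans ltrp _.
  by exists q; split=> //; apply: leq_trans (ltnW ltrp).
exists p; split=> // r r0 rz; rewrite leqNgt; apply/negP=> ltrp.
by apply: nr; exists r.
Qed.

(* The elements of K(z) are polynomials in z because z is algebraic. *)
Lemma algebraic_frac_horner (K : fieldType) (f : {rmorphism K -> L}) (z : L)
    (p a b : {poly K}) :
    p != 0 -> root (map_poly f p) z -> (map_poly f b).[z] != 0 ->
  exists2 q : {poly K}, (size q < size p)%N &
    (map_poly f a).[z] / (map_poly f b).[z] = (map_poly f q).[z].
Proof.
move=> p0 pz b0; have [q [q0 qz leqp qmin]] := min_annihilator p0 pz.
(* A common divisor of q and b does not vanish at z, because b does not; dividing q by it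
   contradicts minimality unless it is constant. *)
have cqb : coprimep q b.
  rewrite coprimep_def; set d := gcdp q b.
  have d0 : (map_poly f d).[z] != 0.
    apply: contraNneq b0 => dz; have /dvdpP[c ->] := dvdp_gcdr q b.
    by rewrite rmorphM hornerM -/d dz mulr0.
  have /dvdpP[c qE] := dvdp_gcdl q b; rewrite -/d in qE.
  move: q0; rewrite qE mulf_eq0 negb_or => /andP[c0 dn0].
  have cz : root (map_poly f c) z.
    by move: qz; rewrite qE rmorphM rootM => /orP[]// /rootP/eqP; rewrite (negPf d0).
  have := qmin c c0 cz; rewrite qE size_mul // (polySpred dn0) addnS /=.
  by rewrite -{2}[size c]addn0 leq_add2l leqn0 => /eqP->.
(* Bezout gives u q + v b = c with c a nonzero constant, so v / c inverts b at z. *)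
have /Bezout_coprimepP[[u v] /= /eqpf_eq[c c0 uv]] := cqb.
have vbz : (map_poly f v).[z] * (map_poly f b).[z] = f c.
  have := congr1 (fun r => (map_poly f r).[z]) uv; rewrite !rmorphD !rmorphM /=.
  by rewrite hornerD !hornerM (rootP qz) mulr0 add0r alg_polyC map_polyC hornerC.
exists ((c^-1 *: (a * v)) %% q).
  by apply: leq_trans leqp; rewrite ltn_modp.
have -> : (map_poly f ((c^-1 *: (a * v)) %% q)).[z] =
    (map_poly f (c^-1 *: (a * v))).[z].
  rewrite [in RHS](divp_eq (c^-1 *: (a * v)) q) rmorphD rmorphM /= hornerD.
  by rewrite hornerM (rootP qz) mulr0 add0r.
rewrite map_polyZ hornerZ rmorphM hornerM fmorphV -vbz invfM.
have v0 : (map_poly f v).[z] != 0.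
  by apply: contra_neq c0 => v0; apply/eqP; rewrite -(fmorph_eq0 f) -vbz v0 mul0r.
by rewrite [_^-1 * _^-1]mulrC mulrACA mulVf // mulr1 mulrC.
Qed.

Lemma adjoin_fix (g : {rmorphism L -> L}) (s : seq L) :
    (forall c, g (iota c) = iota c) -> {in s, forall x, g x = x} ->
  {in adjoin iota s, forall x, g x = x}.
Proof.
move=> gc gs x /asboolP; elim=> [c|y ys|y t _ gy _ gt|y t _ gy _ gt].
- exact: gc.
- exact: gs.
- by rewrite rmorphB gy gt.
- by rewrite fmorph_div gy gt.
Qed.

(* Write h = q(z) with q of degree < n over s; then q - h vanishes at the n
   conjugates of z under g, so that q is the constant h. *)
Lemma adjoin_fixed (g : {rmorphism L -> L}) (s : seq L) (z h : L) n
    (Q : {poly L}) :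
    (forall c, g (iota c) = iota c) -> {in s, forall x, g x = x} ->
    Q \is a polyOver (adjoin iota s) -> Q != 0 -> (size Q <= n.+1)%N ->
    root Q z -> uniq (mkseq (fun i => iter i g z) n) ->
    h \in adjoin iota (z :: s) -> g h = h ->
  h \in adjoin iota s.
Proof.
move=> gc gs QS Q0 szQ Qz conj hzs gh.
pose K := subfield_of (adjoin iota s); pose f : {rmorphism K -> L} := val.
have [p pE] : exists p : {poly K}, Q = map_poly f p := polyOver_subfield QS.
have p0 : p != 0 by apply: contraNneq Q0 => p0; rewrite pE p0 rmorph0.
have pz : root (map_poly f p) z by rewrite -pE.
pose ev : {rmorphism {poly K} -> L} := horner_eval z \o map_poly f.
have evE r : ev r = (map_poly f r).[z] by [].
have : h \in frac_image ev.
  apply: adjoin_frac_image hzs => [c|x].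
    exists (SubfieldOf (adjoin_const iota s c) : K)%:P.
    by rewrite evE map_polyC hornerC.
  rewrite inE => /predU1P[->|/(mem_adjoin iota) sx].
    by exists 'X; rewrite evE map_polyX hornerX.
  by exists (SubfieldOf sx : K)%:P; rewrite evE map_polyC hornerC.
case/frac_imageP=> a [b [b0 hE]]; rewrite !evE in b0 hE.
have [q ltqp qE] := algebraic_frac_horner a p0 pz b0.
have gK (c : K) : g (f c) = f c by apply: adjoin_fix gc gs _ (valP c).
have gq i : (map_poly f q).[iter i g z] = h.
  elim: i => [|i IHi]; first by rewrite hE qE.
  rewrite iterS -gh -IHi -horner_map /= -map_poly_comp.
  by congr (_.[_]); apply: eq_map_poly => c; rewrite /= gK.
pose T := map_poly f q - h%:P.
have T0 : T = 0.
  apply/eqP/negPn/negP=> T0; have rT : all (root T) (mkseq (fun i => iter i g z) n).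
    apply/allP=> x /mapP[i _ ->]; rewrite rootE /T hornerD hornerN hornerC.
    by rewrite gq subrr.
  have := max_poly_roots T0 rT conj; rewrite size_mkseq ltnNge => /negP[].
  have ltqn : (size (map_poly f q) <= n)%N.
    rewrite size_map_poly -ltnS; apply: leq_trans szQ.
    by rewrite pE size_map_poly.
  apply: leq_trans (size_polyD _ _) _; rewrite geq_max ltqn size_polyN.
  (* [Q] has a root, so its size exceeds 1 and n is positive: the constant [h] fits the bound as
     well. *)
  apply: leq_trans (size_polyC_leq1 _) _.
  rewrite -ltnS; apply: leq_trans szQ.
  exact: root_size_gt1 Q0 Qz.
have -> : h = f q`_0.
  have := congr1 (fun r : {poly L} => r`_0) T0.
  by rewrite coef0 coefB coefC coef_map /= => /subr0_eq.
exact: valP.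
Qed.

End FixedElements.

(** * Coordinates on a block of p variables *)

Section PrimeSubfield.
Variables (p : nat) (p_prime : prime p) (L : fieldType).
Hypothesis char_L : p \in [pchar L].

Definition Fp_in (i : 'F_p) : L := (i : nat)%:R.

Let modFp n : (n %% p)%N = (n %% (Zp_trunc (pdiv p)).+2)%N.
Proof. by rewrite Fp_cast. Qed.

Fact Fp_in_zmod : zmod_morphism Fp_in.
Proof.
move=> i j; have FD u v : Fp_in (u + v) = Fp_in u + Fp_in v.
  by rewrite -natrD -(GRing.natr_mod_pchar char_L) modFp.
by apply: (addIr (Fp_in j)); rewrite -FD !subrK.
Qed.

Fact Fp_in_monoid : monoid_morphism Fp_in.
Proof.
split=> [|i j]; first by [].
by rewrite -natrM -(GRing.natr_mod_pchar char_L) modFp.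
Qed.
HB.instance Definition _ :=
  GRing.isZmodMorphism.Build _ _ Fp_in Fp_in_zmod.
HB.instance Definition _ :=
  GRing.isMonoidMorphism.Build _ _ Fp_in Fp_in_monoid.

Lemma Fp_exprp (i : 'F_p) : i ^+ p = i.
Proof. by have := expf_card i; rewrite card_Fp. Qed.

Lemma Fp_in_exprp i : Fp_in i ^+ p = Fp_in i.
Proof. by rewrite -rmorphXn Fp_exprp. Qed.

(** Fermat: this power is the indicator of the nonzero elements, on which the interpolation in
    [coord_rpred] rests. *)
Lemma Fp_expr_pred (i : 'F_p) : i ^+ p.-1 = (i != 0)%:R.
Proof.
have /negPf p1 : (p.-1 != 0)%N by rewrite -lt0n -subn1 subn_gt0 prime_gt1.
have [->|i0] := eqVneq; first by rewrite expr0n p1.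
by apply: (mulfI i0); rewrite -exprS prednK ?prime_gt0 // Fp_exprp mulr1.
Qed.

Lemma exprpB (u v : L) : (u - v) ^+ p = u ^+ p - v ^+ p.
Proof. exact: (pFrobenius_autB_comm char_L (mulrC u v)). Qed.

Lemma Fp_in_inj : injective Fp_in.
Proof. exact: fmorph_inj. Qed.

Lemma Fp_in_eq0 i : (Fp_in i == 0) = (i == 0).
Proof. exact: fmorph_eq0. Qed.

Lemma Fp_inN1 : Fp_in (-1) = -1.
Proof. by rewrite rmorphN rmorph1. Qed.

Lemma Fp_inV i : Fp_in i^-1 = (Fp_in i)^-1.
Proof. exact: fmorphV. Qed.

Lemma Fp_inX i n : Fp_in (i ^+ n) = Fp_in i ^+ n.
Proof. exact: rmorphXn. Qed.

Section Coordinates.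
Variable X : 'F_p -> L.

(** With X_i as the mass at the point i, [cz] is the centre of mass and [ct j] the j-th central
    moment; [cz], [cZ] and [ctau j] are the z, Z and tau_j of the idea above. *)
Definition csum := \sum_i X i.
Definition cz := (\sum_i Fp_in i * X i) / csum.
Definition cZ := cz ^+ p - cz.
Definition ct (j : nat) := \sum_i (Fp_in i - cz) ^+ j * X i.
Definition ctau (j : nat) := ct j / cZ ^+ j.

Lemma ct0 : ct 0 = csum.
Proof. by apply: eq_bigr => i _; rewrite expr0 mul1r. Qed.

(** The first central moment is zero, which is why the index 1 is absent from [tau_indices]. *)
Lemma ct1 : csum != 0 -> ct 1 = 0.
Proof.
move=> s0; rewrite /ct (eq_bigr (fun i => Fp_in i * X i - cz * X i)) => [|i _].
  by rewrite sumrB -mulr_sumr /cz divfK // subrr.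
by rewrite expr1 mulrBl.
Qed.

(* 1 - (m - i)^(p-1) is the indicator of m = i; expand it in powers of
   m - cz X. *)
Lemma coord_rpred (S : divringClosed L) i :
  cz \in S -> (forall j, (j < p)%N -> ct j \in S) -> X i \in S.
Proof.
move=> zS tS.
have -> : X i = \sum_m (1 - (Fp_in m - Fp_in i) ^+ p.-1) * X m.
  rewrite (bigD1 i) //= subrr -{1}(rmorph0 Fp_in) -rmorphXn Fp_expr_pred eqxx.
  rewrite rmorph0 subr0 mul1r big1 ?addr0 // => m mi.
  by rewrite -rmorphB -rmorphXn Fp_expr_pred subr_eq0 mi rmorph1 subrr mul0r.
have -> : \sum_m (1 - (Fp_in m - Fp_in i) ^+ p.-1) * X m = ct 0 -
    \sum_(l < p.-1.+1) (\sum_m (Fp_in m - cz) ^+ (p.-1 - l) * X m) *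
       (cz - Fp_in i) ^+ l *+ 'C(p.-1, l).
  rewrite (eq_bigr (fun m => X m - \sum_(l < p.-1.+1)
     (Fp_in m - cz) ^+ (p.-1 - l) * X m * (cz - Fp_in i) ^+ l *+ 'C(p.-1, l))).
    rewrite sumrB ct0; congr (_ - _); rewrite exchange_big /=.
    by apply: eq_bigr => l _; rewrite sumrMnl -mulr_suml.
  move=> m _; rewrite mulrBl mul1r; congr (_ - _).
  rewrite -[_ - Fp_in i](subrKA cz) exprDn mulr_suml; apply: eq_bigr => l _.
  by rewrite mulrnAl mulrAC.
have ltp (l : nat) : (p.-1 - l < p)%N.
  by rewrite (leq_ltn_trans (leq_subr _ _)) // ltn_predL prime_gt0.
rewrite rpredB ?tS ?prime_gt0 // rpred_sum // => l _.
by rewrite rpredMn // rpredM ?tS // rpredX // rpredB // rpred_nat.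
Qed.

End Coordinates.

Lemma csum_ext X X' : X =1 X' -> csum X = csum X'.
Proof. by move=> e; apply: eq_bigr. Qed.

Lemma cz_ext X X' : X =1 X' -> cz X = cz X'.
Proof.
by move=> e; rewrite /cz (csum_ext e); congr (_ / _); apply: eq_bigr => i _; rewrite e.
Qed.

Lemma cZ_ext X X' : X =1 X' -> cZ X = cZ X'.
Proof. by move=> e; rewrite /cZ (cz_ext e). Qed.

Lemma ct_ext X X' j : X =1 X' -> ct X j = ct X' j.
Proof. by move=> e; rewrite /ct (cz_ext e); apply: eq_bigr => i _; rewrite e. Qed.

Lemma ctau_ext X X' j : X =1 X' -> ctau X j = ctau X' j.
Proof. by move=> e; rewrite /ctau (ct_ext _ e) (cZ_ext e). Qed.

Section Morphism.
Variable g : {rmorphism L -> L}.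

Lemma rmorph_Fp_in i : g (Fp_in i) = Fp_in i.
Proof. exact: rmorph_nat. Qed.

Lemma rmorph_cz X : g (cz X) = cz (g \o X).
Proof.
rewrite /cz fmorph_div !rmorph_sum; congr (_ / _).
by apply: eq_bigr => i _; rewrite rmorphM rmorph_Fp_in.
Qed.

Lemma rmorph_cZ X : g (cZ X) = cZ (g \o X).
Proof. by rewrite rmorphB rmorphXn rmorph_cz. Qed.

Lemma rmorph_ctau X j : g (ctau X j) = ctau (g \o X) j.
Proof.
rewrite fmorph_div rmorphXn rmorph_cZ rmorph_sum; congr (_ / _).
by apply: eq_bigr => i _; rewrite rmorphM rmorphXn rmorphB rmorph_Fp_in rmorph_cz.
Qed.

End Morphism.

(** * Affine changes of the index *)

Section AffineSubstitution.
Variables (X : 'F_p -> L) (u d : 'F_p).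
Hypotheses (u0 : u != 0) (X0 : csum X != 0).
Let Y i := X (u * i + d).
Let aff_bij : bijective (fun i : 'F_p => u^-1 * (i - d)).
Proof.
by exists (fun i => u * i + d) => i; rewrite ?addrK ?mulKf // mulVKf // subrK.
Qed.
Let affK i : u * (u^-1 * (i - d)) + d = i.
Proof. by rewrite mulVKf // subrK. Qed.
Let affE i : Fp_in (u^-1 * (i - d)) = (Fp_in u)^-1 * (Fp_in i - Fp_in d).
Proof. by rewrite rmorphM rmorphB fmorphV. Qed.

Lemma csum_aff : csum Y = csum X.
Proof.
rewrite /csum (reindex _ (onW_bij _ aff_bij)) /=.
by apply: eq_bigr => i _; rewrite /Y affK.
Qed.

Lemma cz_aff : cz Y = (Fp_in u)^-1 * (cz X - Fp_in d).
Proof.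
rewrite /cz csum_aff (reindex _ (onW_bij _ aff_bij)) /=.
rewrite (eq_bigr (fun i => (Fp_in u)^-1 * (Fp_in i * X i - Fp_in d * X i))).
  by rewrite -mulr_sumr sumrB -mulr_sumr -mulrA mulrBl mulfK.
by move=> i _; rewrite /Y affK affE -mulrA mulrBl.
Qed.

(** Frobenius is additive and fixes the prime field, so the translation cancels in z^p - z. *)
Lemma cZ_aff : cZ Y = (Fp_in u)^-1 * cZ X.
Proof.
rewrite /cZ cz_aff exprMn exprVn Fp_in_exprp exprpB Fp_in_exprp -mulrBr.
by rewrite opprB addrA subrK.
Qed.

(** Numerator and denominator both acquire the factor u^(-j). *)
Lemma ctau_aff j : ctau Y j = ctau X j.
Proof.
rewrite /ctau cZ_aff; have u1 : Fp_in u != 0 by rewrite Fp_in_eq0.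
have -> : ct Y j = (Fp_in u)^-1 ^+ j * ct X j.
  rewrite /ct (reindex _ (onW_bij _ aff_bij)) /= mulr_sumr.
  apply: eq_bigr => i _; rewrite /Y affK affE cz_aff -mulrBr opprB.
  by rewrite addrA subrK exprMn mulrA.
by rewrite exprMn -mulf_div divff ?mul1r // expf_neq0 // invr_neq0.
Qed.

End AffineSubstitution.

End PrimeSubfield.

(** * The fixed fields *)

(* v stands for the family of variables of a rational function field L = k(I),
   of which only the three hypotheses on v are used. *)
Section Main.
Variables (p : nat) (p_prime : prime p) (p_odd : odd p).
Local Notation I := ('F_p + 'F_p)%type.
Variables (k L : fieldType) (iota : {rmorphism k -> L}) (v : I -> L).
Hypothesis char_L : p \in [pchar L].
Hypothesis v_gen : forall s, (forall i, v i \in adjoin iota s) ->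
  forall z, z \in adjoin iota s.
Hypothesis v_free : forall i (r : seq I), i \notin r -> v i \notin alg iota (map v r).
Hypothesis v_size : forall s, (forall i, v i \in alg iota s) ->
  (#|{: I}| <= size s)%N.
Local Notation x := (fun i : 'F_p => v (inl i)).
Local Notation y := (fun i : 'F_p => v (inr i)).
Local Notation adj s := (adjoin iota s).

Let two_neq0 : 2%:R != 0 :> L.
Proof.
rewrite -(dvdn_pcharf char_L); apply/negP=> /dvdn_leq p2.
have : p = 2%N by apply/eqP; rewrite eqn_leq p2 // prime_gt1.
by move: p_odd => /[swap] ->.
Qed.

(* Locked: otherwise rewriting by inE unfolds the first element. *)
Definition tau_indices : seq nat := locked (0%N :: seq.iota 2 (p - 2)).
Definition taus (X : 'F_p -> L) := [seq ctau X j | j <- tau_indices].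

Lemma size_tau_indices : size tau_indices = p.-1.
Proof. by rewrite /tau_indices -lock /= size_iota -subSn ?prime_gt1 // subn2. Qed.

Lemma mem_tau_indices j : (j < p)%N -> (j == 1%N) || (j \in tau_indices).
Proof.
move=> jp; rewrite /tau_indices -lock inE mem_iota (subnKC (prime_gt1 p_prime)) jp andbT.
by case: j {jp} => [|[]].
Qed.

Lemma coord_taus_rpred (S : divringClosed L) (X : 'F_p -> L) :
    csum X != 0 -> cZ X != 0 -> cz X \in S -> {subset taus X <= S} ->
  forall i, X i \in S.
Proof.
move=> s0 Z0 zS tS i; apply: (coord_rpred p_prime char_L) => // j jp.
have /orP[/eqP->|jt] := mem_tau_indices jp; first by rewrite ct1 // rpred0.
have -> : ct X j = ctau X j * cZ X ^+ j by rewrite divfK // expf_neq0.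
have ZS : cZ X \in S by rewrite rpredB ?rpredX.
by apply: rpredM; [apply/tS/map_f | apply: rpredX].
Qed.

(** For c = [cZ X] the roots are [cz X] and its translates by the prime field, the conjugates under
    a translation of the index. *)
Definition artin_schreier (c : L) : {poly L} := 'X^p - 'X - c%:P.

Lemma size_artin_schreier c : size (artin_schreier c) = p.+1.
Proof.
rewrite /artin_schreier -addrA size_polyDl ?size_polyXn // ltnS.
rewrite (leq_trans (size_polyD _ _)) // geq_max !size_polyN size_polyX.
by rewrite prime_gt1 // (leq_trans (size_polyC_leq1 _)) // prime_gt0.
Qed.

Lemma artin_schreier_neq0 c : artin_schreier c != 0.
Proof. by rewrite -size_poly_gt0 size_artin_schreier. Qed.

Lemma root_artin_schreier (X : 'F_p -> L) : root (artin_schreier (cZ X)) (cz X).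
Proof. by rewrite rootE !hornerE subrr. Qed.

Lemma polyOver_artin_schreier (S : divringClosed L) c :
  c \in S -> artin_schreier c \is a polyOver S.
Proof. by move=> cS; rewrite !rpredB ?rpredX ?polyOverX ?polyOverC. Qed.

Lemma cz_alg s (X : 'F_p -> L) : cZ X \in alg iota s -> cz X \in alg iota s.
Proof.
move=> Zs; apply: alg_root (artin_schreier_neq0 (cZ X)) (root_artin_schreier X).
exact: polyOver_artin_schreier.
Qed.

Section Block.
Variables (f : 'F_p -> I) (f_inj : injective f).
Let X i := v (f i).

(** If the sum vanished, [X 0] would be algebraic over the other variables of its block. *)
Lemma csum_neq0 : csum X != 0.
Proof.
apply/negP=> /eqP; rewrite /csum (bigD1 0) //= => /eqP; rewrite addr_eq0 => /eqP X0.
have nf : f 0 \notin [seq f i | i <- enum (predC1 0)].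
  by rewrite mem_map // mem_enum inE eqxx.
have /negP[] := v_free nf.
rewrite -/(X 0) X0 rpredN rpred_sum // => i i0.
by apply/mem_alg/map_f/map_f; rewrite mem_enum.
Qed.

(** A count: if Z were 0, then z would be algebraic over k, and all variables would be algebraic
    over p - 1 moments and the p variables of the other block. The moments [ct] are used because
    [ctau] would divide by 0. *)
Lemma cZ_neq0 : cZ X != 0.
Proof.
apply/negP=> /eqP Z0; pose rest := enum [predC codom f].
pose s := [seq ct X j | j <- tau_indices] ++ map v rest.
have sX i : X i \in alg iota s.
  apply: (coord_rpred p_prime char_L); first by rewrite cz_alg // Z0 rpred0.
  move=> j /mem_tau_indices/orP[/eqP->|jt].
    by rewrite ct1 ?csum_neq0 // rpred0.
  by apply: mem_alg; rewrite mem_cat map_f.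
have /v_size : forall i, v i \in alg iota s.
  move=> i; have [/codomP[j ->]|ni] := boolP (i \in codom f); first exact: sX.
  by apply: mem_alg; rewrite mem_cat map_f ?orbT // mem_enum.
rewrite size_cat !size_map size_tau_indices -cardE -(cardC (mem (codom f))).
by rewrite card_codom // card_Fp // leq_add2r leqNgt ltn_predL prime_gt0.
Qed.

End Block.

Lemma inl_inj : injective (inl : 'F_p -> I). Proof. by move=> ? ? []. Qed.
Lemma inr_inj : injective (inr : 'F_p -> I). Proof. by move=> ? ? []. Qed.
Let sx := csum_neq0 inl_inj.
Let sy := csum_neq0 inr_inj.
Let Zx := cZ_neq0 inl_inj.
Let Zy := cZ_neq0 inr_inj.

Lemma ratvar_rpred (S : divringClosed L) :
    cz x \in S -> cz y \in S ->
    {subset taus x <= S} -> {subset taus y <= S} ->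
  forall i, v i \in S.
Proof.
move=> xS yS tx ty [] i.
  exact: (coord_taus_rpred sx Zx).
exact: (coord_taus_rpred sy Zy).
Qed.

(** The same count: the list has 2p - 1 elements, and with Z algebraic over it all 2p variables
    would be. *)
Lemma cZx_notin_alg : cZ x \notin alg iota (cZ y :: taus x ++ taus y).
Proof.
set s := _ :: _; apply/negP=> Zs.
have /v_size : forall i, v i \in alg iota s.
  apply: ratvar_rpred; try apply: cz_alg => //.
  - exact/mem_alg/mem_head.
  - by move=> t ts; apply: mem_alg; rewrite inE mem_cat ts orbT.
  - by move=> t ts; apply: mem_alg; rewrite inE mem_cat ts !orbT.
rewrite card_sum card_Fp // /s -cat1s !size_cat !size_map size_tau_indices.
by rewrite addnA add1n prednK ?prime_gt0 // leq_add2l leqNgt ltn_predL prime_gt0.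
Qed.

(** Otherwise Z would be algebraic over W. This yields q != r and a nonzero denominator in the two
    cases below. *)
Lemma cZ_expr_neq e c : (0 < e)%N -> cZ x ^+ e != iota c * cZ y ^+ e.
Proof.
move=> e0; apply: contra cZx_notin_alg => /eqP eq; apply: (alg_expr e0).
rewrite eq; apply: rpredM; first exact/adjoin_alg/adjoin_const.
exact/rpredX/mem_alg/mem_head.
Qed.

Lemma natr_inj : {in gtn p &, injective (fun i => i%:R : L)}.
Proof.
have Fn i : i%:R = Fp_in L (i%:R : 'F_p) by rewrite rmorph_nat.
move=> i j; rewrite !inE => ip jp; rewrite !Fn => /(Fp_in_inj p_prime char_L).
by move/(congr1 val); rewrite /= !val_Fp_nat // !modn_small //; apply.
Qed.

Lemma artin_schreier_fixed (g : kaut iota) s (X : 'F_p -> L) h :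
    {in s, forall z, g z = z} -> cZ X \in adj s -> g (cz X) = cz X - 1 ->
    h \in adj (cz X :: s) -> g h = h ->
  h \in adj s.
Proof.
move=> gs Zs gz; apply: (adjoin_fixed (n := p) (Q := artin_schreier (cZ X))) => //.
- exact: kaut_const.
- exact: polyOver_artin_schreier.
- exact: artin_schreier_neq0.
- by rewrite size_artin_schreier.
- exact: root_artin_schreier.
have gi i : iter i g (cz X) = cz X - i%:R.
  elim: i => [|i IHi]; first by rewrite subr0.
  by rewrite iterS IHi rmorphB gz rmorph_nat -addn1 natrD opprD addrA addrAC.
apply/mkseq_uniqP=> i j ip jp; rewrite !gi => /addrI/oppr_inj.
exact: natr_inj.
Qed.


(** * The fixed field for multipliers u, w of rho and eps of lambda *)

Section FixedField.
Variables (sigma1 sigma2 lambda rho : kaut iota) (u w eps : 'F_p).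
Hypothesis sigma1E : forall i, sigma1 (x i) = x (i + 1) /\ sigma1 (y i) = y i.
Hypothesis sigma2E : forall i, sigma2 (x i) = x i /\ sigma2 (y i) = y (i + 1).
Hypothesis lambdaE :
  forall i, lambda (x i) = y (eps * i) /\ lambda (y i) = x i.
Hypothesis rhoE : forall i, rho (x i) = x (u * i) /\ rho (y i) = y (w * i).
Hypotheses (u0 : u != 0) (w0 : w != 0) (eps0 : eps != 0).
Hypothesis u_gen : {in gtn p.-1 &, injective (GRing.exp u)}.
Local Notation Z := (cZ x).
Local Notation W := (cZ y).

(** Every generator carries a block to a block by an affine change of the index, so one computation
    serves all of them. *)
Let kaut_coord (g : kaut iota) (X X' : 'F_p -> L) (c d : 'F_p) :
    c != 0 -> csum X' != 0 -> (forall i, g (X i) = X' (c * i + d)) ->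
  [/\ g (cz X) = (Fp_in L c)^-1 * (cz X' - Fp_in L d),
      g (cZ X) = (Fp_in L c)^-1 * cZ X' & forall j, g (ctau X j) = ctau X' j].
Proof.
move=> c0 s0 gX; have ext : g \o X =1 (fun i => X' (c * i + d)) by [].
split=> [||j].
- by rewrite rmorph_cz (cz_ext ext) cz_aff.
- by rewrite rmorph_cZ (cZ_ext ext) cZ_aff.
- by rewrite rmorph_ctau (ctau_ext _ ext) ctau_aff.
Qed.

Let Fp1 : (Fp_in L (1 : 'F_p)) = 1. Proof. by []. Qed.
Let Fp0 : (Fp_in L (0 : 'F_p)) = 0. Proof. by []. Qed.

Lemma sigma1_coord : [/\ sigma1 (cz x) = cz x - 1, sigma1 (cz y) = cz y,
  sigma1 Z = Z /\ sigma1 W = W &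
  forall j, sigma1 (ctau x j) = ctau x j /\ sigma1 (ctau y j) = ctau y j].
Proof.
have [|i|xz xZ xt] := @kaut_coord sigma1 x x 1 1 _ sx; rewrite ?oner_neq0 //.
  by rewrite mul1r (sigma1E i).1.
have [|i|yz yZ yt] := @kaut_coord sigma1 y y 1 0 _ sy; rewrite ?oner_neq0 //.
  by rewrite mul1r addr0 (sigma1E i).2.
by rewrite xz xZ yz yZ Fp1 Fp0 invr1 !mul1r subr0.
Qed.

Lemma sigma2_coord : [/\ sigma2 (cz x) = cz x, sigma2 (cz y) = cz y - 1,
  sigma2 Z = Z /\ sigma2 W = W &
  forall j, sigma2 (ctau x j) = ctau x j /\ sigma2 (ctau y j) = ctau y j].
Proof.
have [|i|xz xZ xt] := @kaut_coord sigma2 x x 1 0 _ sx; rewrite ?oner_neq0 //.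
  by rewrite mul1r addr0 (sigma2E i).1.
have [|i|yz yZ yt] := @kaut_coord sigma2 y y 1 1 _ sy; rewrite ?oner_neq0 //.
  by rewrite mul1r (sigma2E i).2.
by rewrite xz xZ yz yZ Fp1 Fp0 invr1 !mul1r subr0.
Qed.

Lemma rho_coord :
  [/\ rho Z = (Fp_in L u)^-1 * Z, rho W = (Fp_in L w)^-1 * W &
  forall j, rho (ctau x j) = ctau x j /\ rho (ctau y j) = ctau y j].
Proof.
have [|i|_ xZ xt] := @kaut_coord rho x x u 0 _ sx; rewrite ?oner_neq0 //.
  by rewrite addr0 (rhoE i).1.
have [|i|_ yZ yt] := @kaut_coord rho y y w 0 _ sy; rewrite ?oner_neq0 //.
by rewrite addr0 (rhoE i).2.
Qed.

Lemma lambda_coord :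
  [/\ lambda Z = (Fp_in L eps)^-1 * W, lambda W = Z &
  forall j, lambda (ctau x j) = ctau y j /\ lambda (ctau y j) = ctau x j].
Proof.
have [|i|_ xZ xt] := @kaut_coord lambda x y eps 0 _ sy; rewrite ?oner_neq0 //.
  by rewrite addr0 (lambdaE i).1.
have [|i|_ yZ yt] := @kaut_coord lambda y x 1 0 _ sx; rewrite ?oner_neq0 //.
  by rewrite mul1r addr0 (lambdaE i).2.
by split=> //; rewrite yZ Fp1 invr1 mul1r.
Qed.

Let T := taus x ++ taus y.

Let fix_taus (g : kaut iota) :
    (forall j, g (ctau x j) = ctau x j /\ g (ctau y j) = ctau y j) ->
  {in T, forall t, g t = t}.
Proof.
move=> gt t; rewrite mem_cat => /orP[]/mapP[j _ ->]; [exact: (gt j).1|].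
exact: (gt j).2.
Qed.

Let fix_cons (g : kaut iota) z s :
  g z = z -> {in s, forall t, g t = t} -> {in z :: s, forall t, g t = t}.
Proof. by move=> gz gs t; rewrite inE => /predU1P[->|/gs]. Qed.

Lemma sigma_fixed h : sigma1 h = h -> sigma2 h = h -> h \in adj (Z :: W :: T).
Proof.
have [z1 w1 [Z1 W1] t1] := sigma1_coord; have [z2 w2 [Z2 W2] t2] := sigma2_coord.
move=> h1 h2.
(* [Z] is redundant beside [cz x], but the Artin-Schreier polynomial that removes [cz x] needs it in
   the base; likewise [W] for [cz y] in the next step. *)
have h3 : h \in adj (cz x :: [:: cz y, Z & T]).
  apply: v_gen; apply: ratvar_rpred => [||t xt|t yt]; apply: mem_adjoin.
  - exact: mem_head.
  - by rewrite 2!inE eqxx orbT.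
  - by rewrite 3!inE mem_cat xt !orbT.
  - by rewrite 3!inE mem_cat yt !orbT.
have h4 : h \in adj (cz y :: [:: Z, W & T]).
  have : h \in adj (cz y :: Z :: T).
    apply: (artin_schreier_fixed (g := sigma1)) h3 h1 => //.
      by do 2!apply: fix_cons => //; apply: fix_taus.
    by apply: mem_adjoin; rewrite 2!inE eqxx orbT.
  by apply: adjoinS => t; rewrite !inE; case/or3P=> ->; rewrite ?orbT.
apply: (artin_schreier_fixed (g := sigma2)) h4 h2 => //.
  by do 2!apply: fix_cons => //; apply: fix_taus.
by apply: mem_adjoin; rewrite 2!inE eqxx orbT.
Qed.

(** The invariant of [rho] that takes the place of [W] beside [Z]: it will be Z / W or Z W in the
    two cases. *)
Variable al : L.
Hypothesis rho_al : rho al = al.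
Hypothesis W_al : W \in adj [:: Z; al].

(** As [u] has order p - 1, the conjugates of [Z] under [rho] are the p - 1 distinct roots of
    T^(p-1) - Z^(p-1). *)
Lemma rho_fixed h :
  h \in adj (Z :: W :: T) -> rho h = h -> h \in adj [:: al, Z ^+ p.-1 & T].
Proof.
have [rZ rW rt] := rho_coord; move=> h1 rh.
have u1 : Fp_in L u != 0 by rewrite Fp_in_eq0.
have uX n : Fp_in L u ^+ n = Fp_in L (u ^+ n) by rewrite Fp_inX.
have p1 : (0 < p.-1)%N by rewrite -subn1 subn_gt0 prime_gt1.
have ZX : Z ^+ p.-1 \in adj [:: al, Z ^+ p.-1 & T].
  by apply: mem_adjoin; rewrite 2!inE eqxx orbT.
apply: (@adjoin_fixed _ _ _ rho _ Z h p.-1 ('X^(p.-1) - (Z ^+ p.-1)%:P)) => //.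
- exact: kaut_const.
- do 2!apply: fix_cons => //; last exact: fix_taus.
  by rewrite rmorphXn rZ exprMn exprVn uX Fp_expr_pred // u0 Fp1 invr1 mul1r.
- by rewrite rpredB ?rpredX ?polyOverX ?polyOverC.
- by rewrite -size_poly_gt0 size_XnsubC.
- by rewrite size_XnsubC.
- by rewrite rootE !hornerE subrr.
- have ri i : iter i rho Z = (Fp_in L u)^-1 ^+ i * Z.
    elim: i => [|i IHi]; first by rewrite mul1r.
    by rewrite iterS IHi rmorphM rmorphXn fmorphV rmorph_Fp_in rZ mulrA -exprSr.
  apply/mkseq_uniqP=> i j ip jp; rewrite !ri => /(mulIf Zx); rewrite !exprVn.
  by move/invr_inj; rewrite !uX => /(Fp_in_inj p_prime char_L); apply: u_gen.
apply: adjoin_sub h1 => t; rewrite 2!inE => /or3P[/eqP->|/eqP->|tT].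
- exact/mem_adjoin/mem_head.
- apply: adjoinS W_al => t'; rewrite !inE.
  by case/orP=> ->; rewrite ?orbT.
- by apply: mem_adjoin; rewrite 3!inE tT !orbT.
Qed.

(** In the notation of the idea, [e1] will be q + r, [del] will be q - r, and [e2] the one more
    element of k(Z, W). *)
Variables e1 e2 del : L.
Hypotheses (e1_ZW : e1 \in adj [:: Z; W]) (e2_ZW : e2 \in adj [:: Z; W]).
Hypotheses (del_ZW : del \in adj [:: Z; W]).
Hypotheses (rho_e1 : rho e1 = e1) (rho_e2 : rho e2 = e2) (rho_del : rho del = del).
Hypotheses (lambda_e1 : lambda e1 = e1) (lambda_e2 : lambda e2 = e2).
Hypotheses (lambda_del : lambda del = - del) (del0 : del != 0).
Hypothesis del2 : del ^+ 2 \in adj [:: e1; e2].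
Hypothesis al_del : al \in adj [:: del; e1; e2].
Hypothesis Z_del : Z ^+ p.-1 \in adj [:: del; e1; e2].

Let A j := ctau x j + ctau y j.
Let B j := del * (ctau x j - ctau y j).
Definition fixed_gens := [:: e1, e2 & map A tau_indices ++ map B tau_indices].

Lemma size_fixed_gens : size fixed_gens = #|{: I}|.
Proof.
rewrite card_sum card_Fp // /fixed_gens -cat1s -(cat1s e2) !size_cat !size_map.
rewrite size_tau_indices addnA addnACA add1n prednK ?prime_gt0 //.
Qed.

(** The tau_j of x and y are half the sum and half the difference of [A j] and [B j / del]; 2 is
    invertible as p is odd. *)
Let taus_gens : {subset T <= adj (del :: fixed_gens)}.
Proof.
move=> t; rewrite mem_cat => tT.
have AB j : j \in tau_indices ->
    A j \in adj (del :: fixed_gens) /\ B j / del \in adj (del :: fixed_gens).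
  move=> jt; split; first by apply: mem_adjoin; rewrite 3!inE mem_cat map_f ?orbT.
  apply: rpred_div; last exact/mem_adjoin/mem_head.
  by apply: mem_adjoin; rewrite 3!inE mem_cat map_f ?orbT.
have BE j : B j / del = ctau x j - ctau y j by rewrite /B mulrAC mulfV // mul1r.
have xE j : ctau x j = (A j + B j / del) / 2%:R.
  by rewrite BE addrACA subrr addr0 -mulr2n -(mulr_natr (ctau x j)) mulfK.
have yE j : ctau y j = (A j - B j / del) / 2%:R.
  rewrite BE opprB addrC addrA subrK.
  by rewrite -mulr2n -(mulr_natr (ctau y j)) mulfK.
case/orP: tT => /mapP[j /AB[Aj Bj] ->].
  by rewrite xE; apply: rpred_div; rewrite ?rpred_nat // rpredD.
by rewrite yE; apply: rpred_div; rewrite ?rpred_nat // rpredB.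
Qed.

Let e_gens z : z \in adj [:: del; e1; e2] -> z \in adj (del :: fixed_gens).
Proof.
by apply: adjoinS => t; rewrite !inE => /or3P[]->; rewrite ?orbT.
Qed.

Lemma lambda_fixed_gens : {in fixed_gens, forall t, lambda t = t}.
Proof.
have [_ _ lt] := lambda_coord; do 2!apply: fix_cons => //.
move=> t; rewrite mem_cat => /orP[]/mapP[j _ ->].
  by rewrite rmorphD (lt j).1 (lt j).2 addrC.
by rewrite rmorphM rmorphB (lt j).1 (lt j).2 lambda_del mulNr -mulrN opprB.
Qed.

(** The disjunction serves two kinds of automorphism: the sigmas fix Z and W, hence all of k(Z, W),
    while for [rho] the three chosen elements are fixed by hypothesis. *)
Lemma fixed_gens_fixed (g : kaut iota) : g Z = Z /\ g W = W \/
    [/\ g e1 = e1, g e2 = e2 & g del = del] ->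
    (forall j, g (ctau x j) = ctau x j /\ g (ctau y j) = ctau y j) ->
  {in fixed_gens, forall t, g t = t}.
Proof.
move=> gZ gt; have [g1 g2 gd] : [/\ g e1 = e1, g e2 = e2 & g del = del].
  case: gZ => // -[gZ gW]; have gZW : {in [:: Z; W], forall t, g t = t}.
    by do 2!apply: fix_cons => //.
  by split; apply: (adjoin_fix (kaut_const g) gZW).
do 2!apply: fix_cons => //.
move=> t; rewrite mem_cat => /orP[]/mapP[j _ ->].
  by rewrite rmorphD (gt j).1 (gt j).2.
by rewrite rmorphM rmorphB (gt j).1 (gt j).2 gd.
Qed.

(** The conjugates of [del] under [lambda] are [del] and [- del], distinct since 2 is nonzero, and
    they are the roots of T^2 - del^2. *)
Lemma lambda_fixed h :
  h \in adj [:: al, Z ^+ p.-1 & T] -> lambda h = h -> h \in adj fixed_gens.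
Proof.
move=> h1 lh.
have d2 : del ^+ 2 \in adj fixed_gens.
  by apply: adjoinS del2 => t; rewrite !inE => /orP[]->; rewrite ?orbT.
apply: (@adjoin_fixed _ _ _ lambda _ del h 2 ('X^2 - (del ^+ 2)%:P)) => //.
- exact: kaut_const.
- exact: lambda_fixed_gens.
- by rewrite rpredB ?rpredX ?polyOverX ?polyOverC.
- by rewrite -size_poly_gt0 size_XnsubC.
- by rewrite size_XnsubC.
- by rewrite rootE !hornerE subrr.
- rewrite /= andbT inE lambda_del -subr_eq0 opprK -mulr2n -(mulr_natr del).
  by rewrite mulf_neq0.
apply: adjoin_sub h1 => t; rewrite 2!inE => /or3P[/eqP->|/eqP->|/taus_gens //].
- exact: e_gens.
- exact: e_gens.
Qed.

(** A tower: [del] is a square root, [Z] a (p - 1)-st root, [W] lies in k(Z, al), and each z is a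
    root of an Artin-Schreier polynomial. *)
Lemma fixed_gens_alg i : v i \in alg iota fixed_gens.
Proof.
have dA : del \in alg iota fixed_gens.
  apply: (@alg_expr _ _ _ _ 2) => //; apply/adjoin_alg.
  by apply: adjoinS del2 => t; rewrite !inE => /orP[]->; rewrite ?orbT.
have delA z : z \in adj (del :: fixed_gens) -> z \in alg iota fixed_gens.
  move=> /adjoin_alg; apply: alg_sub => t; rewrite inE => /predU1P[-> //|].
  exact: mem_alg.
have p1 : (0 < p.-1)%N by rewrite -subn1 subn_gt0 prime_gt1.
have ZA : Z \in alg iota fixed_gens by apply: alg_expr p1 _; apply/delA/e_gens.
have WA : W \in alg iota fixed_gens.
  apply: alg_sub (adjoin_alg W_al) => t; rewrite !inE => /orP[]/eqP-> //.
  exact/delA/e_gens.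
apply: ratvar_rpred; try exact: cz_alg.
  by move=> t tx; apply/delA/taus_gens; rewrite mem_cat tx.
by move=> t tx; apply/delA/taus_gens; rewrite mem_cat tx orbT.
Qed.

Lemma fixed_subfieldE z :
  fixed_subfield (kaut_gen [:: sigma1; sigma2; lambda; rho]) z <->
  z \in adj fixed_gens.
Proof.
have [_ _ ZW1 t1] := sigma1_coord; have [_ _ ZW2 t2] := sigma2_coord.
have [_ _ rt] := rho_coord.
split=> [zG|zs s].
  have fixz g : List.In g [:: sigma1; sigma2; lambda; rho] -> g z = z.
    by move=> gS; apply/zG/kaut_gen_mem.
  apply: lambda_fixed; last by apply: fixz; do 2!right; left.
  apply: rho_fixed; last by apply: fixz; do 3!right; left.
  by apply: sigma_fixed; apply: fixz; [left | right; left].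
elim=> [g gS||g h _ gz _ hz|g _ gz] //=; last 2 first.
- by rewrite hz gz.
- by rewrite -{1}gz kaut_funK.
have gs : {in fixed_gens, forall t, g t = t}.
  case: gS => [<-|[<-|[<-|[<-|[]]]]].
  - by apply: fixed_gens_fixed t1; left.
  - by apply: fixed_gens_fixed t2; left.
  - exact: lambda_fixed_gens.
  - by apply: fixed_gens_fixed rt; right.
exact: (adjoin_fix (kaut_const g) gs).
Qed.

End FixedField.

(** The hypotheses of [k_rational_adjoin], restated for the abstract family [v]. *)
Definition rational_basis (F : L -> Prop) (s : seq L) :=
  [/\ size s = #|{: I}|, forall i, v i \in alg iota s &
      forall z, F z <-> z \in adj s].

(** * The two kinds of rho: equal and inverse multipliers *)

Section TwoCases.
Variables (sigma1 sigma2 lambda rho : kaut iota) (u w eps : 'F_p).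
Hypothesis sigma1E : forall i, sigma1 (x i) = x (i + 1) /\ sigma1 (y i) = y i.
Hypothesis sigma2E : forall i, sigma2 (x i) = x i /\ sigma2 (y i) = y (i + 1).
Hypothesis lambdaE :
  forall i, lambda (x i) = y (eps * i) /\ lambda (y i) = x i.
Hypothesis rhoE : forall i, rho (x i) = x (u * i) /\ rho (y i) = y (w * i).
Hypotheses (u0 : u != 0) (w0 : w != 0) (epsE : eps = 1 \/ eps = -1).
Hypothesis u_gen : {in gtn p.-1 &, injective (GRing.exp u)}.
Local Notation Z := (cZ x).
Local Notation W := (cZ y).
Local Notation F := (fixed_subfield (kaut_gen [:: sigma1; sigma2; lambda; rho])).
Let eta : L := Fp_in L eps.

Let eps0 : eps != 0.
Proof. by case: epsE => ->; rewrite ?oppr_eq0 oner_neq0. Qed.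

Let iota_eta : iota (Fp_in k eps) = eta.
Proof. exact: rmorph_nat. Qed.

Let etaE : eta = (-1) ^+ (eps != 1).
Proof.
rewrite /eta; have [->|e1] := eqVneq eps 1; first by [].
by case: epsE e1 => -> //; rewrite ?eqxx // Fp_inN1.
Qed.

Let etaV : eta^-1 = eta.
Proof. by rewrite etaE; case: (eps != 1); rewrite ?invrN invr1. Qed.

Let lambdaZ : lambda Z = eta * W.
Proof. by have [-> _ _] := lambda_coord lambdaE eps0; rewrite etaV. Qed.
Let lambdaW : lambda W = Z.
Proof. by have [_ -> _] := lambda_coord lambdaE eps0. Qed.
Let rhoZ : rho Z = (Fp_in L u)^-1 * Z.
Proof. by have [-> _ _] := rho_coord rhoE u0 w0. Qed.
Let rhoW : rho W = (Fp_in L w)^-1 * W.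
Proof. by have [_ -> _] := rho_coord rhoE u0 w0. Qed.

Let bV (c : 'F_p) : c != 0 -> (Fp_in L c)^-1 ^+ p.-1 = 1.
Proof.
by move=> c0; rewrite exprVn -Fp_inX // Fp_expr_pred // c0 invr1.
Qed.

Let memZ : Z \in adj [:: Z; W]. Proof. exact/mem_adjoin/mem_head. Qed.
Let memW : W \in adj [:: Z; W].
Proof. by apply: mem_adjoin; rewrite !inE eqxx orbT. Qed.

(* If lambda exchanges q and r, then q + r is fixed, q - r changes sign, and
   (q - r)^2 = (q + r)^2 - 4 q r. *)
Let basis_of_swap (al q r e2 : L) (n : int) :
    rho al = al -> W \in adj [:: Z; al] -> q \in adj [:: Z; W] ->
    e2 \in adj [:: Z; W] -> q * r = n%:~R -> q != 0 -> q != r ->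
    rho q = q -> rho e2 = e2 -> lambda q = r -> lambda r = q ->
    lambda e2 = e2 -> al \in adj [:: q - r; q + r; e2] ->
    Z ^+ p.-1 \in adj [:: q - r; q + r; e2] ->
  exists s, rational_basis F s.
Proof.
move=> rho_al W_al q_ZW e2_ZW qr q0 qr_neq rho_q rho_e2 lq lr le2 al_del Z_del.
have rE : r = n%:~R / q by rewrite -qr mulrAC mulfV ?mul1r.
have r_ZW : r \in adj [:: Z; W] by rewrite rE rpred_div ?rpred_int.
have rho_r : rho r = r by rewrite rE fmorph_div rmorph_int rho_q.
have del2 : (q - r) ^+ 2 \in adj [:: q + r; e2].
  have -> : (q - r) ^+ 2 = (q + r) ^+ 2 - n%:~R *+ 4.
    by rewrite -qr; ring.
  rewrite rpredB ?rpredMn ?rpred_int ?rpredX //.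
  exact/mem_adjoin/mem_head.
exists (fixed_gens (q + r) e2 (q - r)); split.
- exact: size_fixed_gens.
- apply: (fixed_gens_alg W_al); rewrite ?subr_eq0 //.
- apply: (fixed_subfieldE sigma1E sigma2E lambdaE rhoE u0 w0 eps0 u_gen rho_al) => //.
  + by rewrite rpredD.
  + by rewrite rpredB.
  + by rewrite rmorphD rho_q rho_r.
  + by rewrite rmorphB rho_q rho_r.
  + by rewrite rmorphD lq lr addrC.
  + by rewrite rmorphB lq lr opprB.
  + by rewrite subr_eq0.
Qed.

(** As [eta] is 1 or -1, its powers are integers; as values of q r they lie in every subfield and
    are fixed by every automorphism. *)
Let etan n : exists m : int, eta ^+ n = m%:~R.
Proof. by exists ((-1) ^+ (eps != 1) ^+ n); rewrite rmorphXn rmorph_sign etaE. Qed.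

Let sum_diff (q r e : L) : q \in adj [:: q - r; q + r; e].
Proof.
have qE : ((q - r) + (q + r)) / 2%:R = q.
  by rewrite addrACA addNr addr0 -mulr2n -(mulr_natr q) mulfK.
have dm : q - r \in adj [:: q - r; q + r; e] by exact/mem_adjoin/mem_head.
have sm : q + r \in adj [:: q - r; q + r; e].
  by apply: mem_adjoin; rewrite !inE eqxx orbT.
by rewrite -{1}qE; apply: rpred_div; [apply: rpredD | apply: rpred_nat].
Qed.

Let e2_mem (q r e : L) : e \in adj [:: q - r; q + r; e].
Proof. by apply: mem_adjoin; rewrite !inE eqxx !orbT. Qed.

(** Here Z / W is itself invariant under [rho] and serves both as [al] and as q. The further element
    is the sum of the (p - 1)-st powers of Z and W: [rho] fixes each power, and [lambda] exchanges
    them because eta^(p-1) = 1. *)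
Lemma scalar_basis : u = w -> exists s, rational_basis F s.
Proof.
move=> uw; pose q := Z / W; have [n etaZ] := etan 1; rewrite expr1 in etaZ.
have q0 : q != 0 by rewrite mulf_neq0 ?invr_neq0.
have rho_q : rho q = q.
  rewrite fmorph_div rhoZ rhoW uw -mulf_div divff ?mul1r //.
  by rewrite invr_neq0 // Fp_in_eq0.
have lq : lambda q = eta / q.
  by rewrite fmorph_div lambdaZ lambdaW /q invf_div mulrA.
have eta0 : eta != 0 by rewrite etaE signr_eq0.
have e20 : Z ^+ p.-1 + W ^+ p.-1 != 0.
  rewrite addr_eq0 -mulN1r -(rmorphN1 iota); apply: cZ_expr_neq.
  by rewrite -subn1 subn_gt0 prime_gt1.
apply: (@basis_of_swap q q (eta / q) (Z ^+ p.-1 + W ^+ p.-1) n) => //.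
- have -> : W = Z / q by rewrite /q invf_div mulrCA mulfV ?mulr1.
  rewrite rpred_div // mem_adjoin // !inE eqxx ?orbT //.
- by rewrite rpred_div.
- by rewrite rpredD ?rpredX.
- by rewrite mulrCA mulfV // mulr1.
(* The equality q = r would give Z^2 = eta W^2. *)
- apply: contraNneq (cZ_expr_neq (Fp_in k eps) (isT : 0 < 2)%N) => qE.
  rewrite iota_eta -[eta](divfK q0) -qE /q.
  by rewrite -expr2 -exprMn divfK.
- by rewrite rmorphD !rmorphXn rhoZ rhoW !exprMn !bV // !mul1r.
- by rewrite fmorph_div lq invf_div mulrCA /eta rmorph_Fp_in -/eta mulfV ?mulr1.
- rewrite rmorphD !rmorphXn lambdaZ lambdaW exprMn -{1}etaV bV // mul1r addrC //.
(* Dividing [e2] by Z^(p-1) leaves 1 + q^(1-p), so q and [e2] determine Z^(p-1). *)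
- set e2 := Z ^+ p.-1 + _; have -> : Z ^+ p.-1 = e2 / (1 + q^-1 ^+ p.-1).
    have Zp0 : Z ^+ p.-1 != 0 by rewrite expf_neq0.
    have -> : 1 + q^-1 ^+ p.-1 = e2 / Z ^+ p.-1.
      by rewrite /q invf_div expr_div_n /e2 mulrDl mulfV.
    by rewrite invf_div mulrCA mulfV ?mulr1.
  by rewrite rpred_div ?e2_mem // rpredD ?rpred1 // rpredX // rpredV sum_diff.
Qed.

(** [rho] scales Z and W by inverse factors, so it fixes Z W and multiplies Z / W by u^(-2); raising
    to the power m = (p - 1) / 2 turns this factor into u^(1-p) = 1. *)
Lemma hyperbolic_basis : w = u^-1 -> exists s, rational_basis F s.
Proof.
move=> wu; pose m := p./2; have [n etaZ] := etan m.
have mE : p.-1 = (m + m)%N.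
  by rewrite addnn -[p in LHS](odd_double_half p) p_odd.
have m0 : (0 < m)%N by rewrite half_gt0 prime_gt1.
pose al := Z * W; pose q := (Z / W) ^+ m; pose r := eta ^+ m / q.
have q0 : q != 0 by rewrite expf_neq0 // mulf_neq0 ?invr_neq0.
have eta0 : eta != 0 by rewrite etaE signr_eq0.
have bu0 : Fp_in L u != 0 by rewrite Fp_in_eq0.
have wV : (Fp_in L w)^-1 = Fp_in L u by rewrite wu Fp_inV // invrK.
have rho_al : rho al = al by rewrite rmorphM rhoZ rhoW wV mulrACA mulVf ?mul1r.
have lal : lambda al = eta * al by rewrite rmorphM lambdaZ lambdaW -mulrA [W * _]mulrC.
have rho_q : rho q = q.
  rewrite rmorphXn fmorph_div rhoZ rhoW wV -mulf_div exprMn -[RHS]mul1r.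
  by congr (_ * _); rewrite -expr2 -exprM mul2n -addnn -mE bV.
have lq : lambda q = r.
  by rewrite rmorphXn fmorph_div lambdaZ lambdaW /r /q -exprVn invf_div -mulrA exprMn.
have lr : lambda r = q.
  rewrite fmorph_div rmorphXn rmorph_Fp_in lq /r invf_div mulrCA mulfV ?mulr1 //.
  by rewrite expf_neq0.
(* The equality q = r would give Z^(p-1) = eta^m W^(p-1). *)
have qr : q != r.
  apply: contraNneq (cZ_expr_neq (Fp_in k eps ^+ m) (_ : 0 < p.-1)%N) => [qE|]; last first.
    by rewrite mE addn_gt0 m0.
  rewrite rmorphXn iota_eta -[eta ^+ m](divfK q0) -/r -qE.
  by rewrite mE -exprD -!exprMn divfK.
have q_ZW : q \in adj [:: Z; W] by rewrite rpredX // rpred_div.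
have r_ZW : r \in adj [:: Z; W] by rewrite rpred_div // etaZ rpred_int.
have al_ZW : al \in adj [:: Z; W] by rewrite rpredM.
(* [lambda] multiplies [al] by eta; when eta = -1 the factor q - r, which also changes sign,
   restores invariance. *)
pose e2 := if eps == 1 then al else al * (q - r).
have al_e2 : al \in adj [:: q - r; q + r; e2].
  have := e2_mem q r e2; rewrite {1}/e2; case: ifP => // _ e2m.
  have qr0 : q - r != 0 by rewrite subr_eq0.
  rewrite -[X in X \in _](mulfK qr0); apply: rpred_div => //.
  exact/mem_adjoin/mem_head.
apply: (@basis_of_swap al q r e2 n) => //.
- have -> : W = al / Z by rewrite /al mulrAC mulfV ?mul1r.
  by rewrite rpred_div // mem_adjoin // !inE eqxx ?orbT.
- by rewrite /e2; case: ifP => // _; rewrite rpredM // rpredB.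
- by rewrite mulrCA mulfV // mulr1.
- rewrite /e2; case: ifP => // _; rewrite rmorphM rmorphB rho_al rho_q.
  by rewrite fmorph_div rho_q rmorphXn rmorph_Fp_in.
- rewrite /e2 etaE in lal *; case: eqP lal => [_|_] lal.
    by rewrite lal mul1r.
  by rewrite rmorphM rmorphB lal lq lr mulN1r mulNr -mulrN opprB.
- have -> : Z ^+ p.-1 = q * al ^+ m.
    rewrite mE exprD -!exprMn; congr (_ ^+ _).
    by rewrite /al mulrA [_ / _ * _]mulrAC divfK.
  by rewrite rpredM ?sum_diff // rpredX.
Qed.

End TwoCases.

End Main.

(** * From a generator of the unit group to the four groups *)

Lemma generator_expr_inj (p : nat) (u : {unit 'F_p}) :
    prime p -> <[u]>%g = [set: {unit 'F_p}] ->
  {in gtn p.-1 &, injective (GRing.exp (val u))}.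
Proof.
move=> p_prime gen_u i j; rewrite !inE => ip jp.
rewrite -!FinRing.val_unitX => /val_inj/eqP; rewrite eq_expg_mod_order.
by rewrite /order gen_u card_finField_unit card_Fp // !modn_small // => /eqP.
Qed.

Theorem theorem1p7
  (p : nat) (p_prime : prime p) (p_odd : odd p)
  (k : fieldType) (char_k : p \in [pchar k])
  (a : int)
  (a_gen : exists2 u : {unit 'F_p}, val u = a%:~R & <[u]>%g = [set: {unit 'F_p}])
  (I := ('F_p + 'F_p)%type)
  (x := fun i : 'F_p => ratvar k (inl i : I))
  (y := fun i : 'F_p => ratvar k (inr i : I))
  (sigma1 sigma2 lambda1 lambda2 rho1 rho2 : kaut (ratconst k I))
  (sigma1E : forall i, sigma1 (x i) = x (i + 1) /\ sigma1 (y i) = y i)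
  (sigma2E : forall i, sigma2 (x i) = x i /\ sigma2 (y i) = y (i + 1))
  (lambda1E : forall i, lambda1 (x i) = y (- i) /\ lambda1 (y i) = x i)
  (lambda2E : forall i, lambda2 (x i) = y i /\ lambda2 (y i) = x i)
  (rho1E : forall i, rho1 (x i) = x (a%:~R * i) /\ rho1 (y i) = y i)
  (rho2E : forall i, rho2 (x i) = x i /\ rho2 (y i) = y (a%:~R * i)) :
  [/\ k_rational (ratconst k I) (fixed_subfield (kaut_gen
        [:: sigma1; sigma2; lambda1; kaut_comp rho1 rho2])),
      k_rational (ratconst k I) (fixed_subfield (kaut_gen
        [:: sigma1; sigma2; lambda1; kaut_comp (kaut_inv rho1) rho2])),
      k_rational (ratconst k I) (fixed_subfield (kaut_gen
        [:: sigma1; sigma2; lambda2; kaut_comp rho1 rho2]))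
    & k_rational (ratconst k I) (fixed_subfield (kaut_gen
        [:: sigma1; sigma2; lambda2; kaut_comp (kaut_inv rho1) rho2]))].
Proof.
have [u uE gen_u] := a_gen; rewrite -{}uE in rho1E rho2E; set b := val u in rho1E rho2E.
have b0 : b != 0 by rewrite -unitfE; apply: valP.
have b_gen : {in gtn p.-1 &, injective (GRing.exp b)} by apply: generator_expr_inj.
(* With the inverse of [rho1] the multiplier on x is [b^-1], whose powers must be distinct as
   well. *)
have bV_gen : {in gtn p.-1 &, injective (GRing.exp b^-1)}.
  by move=> i j ip jp; rewrite !exprVn => /invr_inj; apply: b_gen.
have bV0 : b^-1 != 0 by rewrite invr_eq0.
have char_L : p \in [pchar ratfun k I] := rmorph_pchar (ratconst k I) char_k.
(* The parameter eps is -1 for [lambda1] and 1 for [lambda2]. *)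
have l1 i : lambda1 (x i) = y (-1 * i) /\ lambda1 (y i) = x i by rewrite mulN1r.
have l2 i : lambda2 (x i) = y (1 * i) /\ lambda2 (y i) = x i by rewrite mul1r.
have r12 i : kaut_comp rho1 rho2 (x i) = x (b * i) /\
             kaut_comp rho1 rho2 (y i) = y (b * i).
  by rewrite /= (rho2E i).1 (rho2E i).2 (rho1E i).1 (rho1E _).2.
have rV12 i : kaut_comp (kaut_inv rho1) rho2 (x i) = x (b^-1 * i) /\
              kaut_comp (kaut_inv rho1) rho2 (y i) = y (b * i).
  rewrite /= (rho2E i).1 (rho2E i).2; split.
    by rewrite -{1}[i](mulVKf b0) -(rho1E _).1 kaut_funK.
  by rewrite -{1}(rho1E (b * i)).2 kaut_funK.
have rational F s :
  rational_basis (ratconst k I) (@ratvar k I) F s -> k_rational (ratconst k I) F.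
  by case=> szs sv FE; apply: k_rational_adjoin szs sv FE.
have scalar := scalar_basis p_prime p_odd char_L (@ratfun_adjoin k I)
  (@ratvar_notin_alg k I) (@ratvar_alg_size k I) sigma1E sigma2E.
have hyperbolic := hyperbolic_basis p_prime p_odd char_L (@ratfun_adjoin k I)
  (@ratvar_notin_alg k I) (@ratvar_alg_size k I) sigma1E sigma2E.
split.
- have [|s /rational //] := scalar _ _ _ _ _ l1 r12 b0 b0 _ b_gen erefl.
  by right.
- have [|s /rational //] := hyperbolic _ _ _ _ _ l1 rV12 bV0 b0 _ bV_gen (esym (invrK b)).
  by right.
- have [|s /rational //] := scalar _ _ _ _ _ l2 r12 b0 b0 _ b_gen erefl.
  by left.
- have [|s /rational //] := hyperbolic _ _ _ _ _ l2 rV12 bV0 b0 _ bV_gen (esym (invrK b)).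
  by left.
Qed.
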